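(* Let $\Gamma=(X,R)$ be a bipartite distance-regular graph with diameter $D\ge 4$ and valency $k\ge 3$. Assume $D$ is odd. Let $\Delta=(k-2)(c_3-1)-(c_2-1)p^2_{22}$. Then the following (i)--(iii) are equivalent: (i) $\Gamma$ is taut; (ii) $\Delta\ne0$ and $\Gamma$ is taut with respect to each vertex; (iii) $\Delta\ne0$ and $\Gamma$ is taut with respect to at least one vertex.
   Context: Graphs are finite, undirected, connected, without loops or multiple edges; $\partial$ denotes path-length distance. A graph $\Gamma=(X,R)$ of diameter $D$ is distance-regular if for all $0\le h,i,j\le D$ and all $x,y\in X$ with $\partial(x,y)=h$ the number $p^h_{ij}=|\{z\in X:\partial(x,z)=i,\ \partial(z,y)=j\}|$ depends only on $h,i,j$. Write $c_i=p^i_{1,i-1}$, $b_i=p^i_{1,i+1}$, $k=b_0$ (the valency). $\Gamma$ is bipartite if $X$ can be partitioned into two subsets neither of which contains an edge. For $0\le i\le D$, $A_i\in\mathrm{Mat}_X(\mathbb C)$ is the $i$th distance matrix: its $(y,z)$ entry is $1$ if $\partial(y,z)=i$ and $0$ otherwise; $A=A_1$ is the adjacency matrix. The distinct eigenvalues of $A$ are real and indexed $\theta_0>\theta_1>\cdots>\theta_D$; put $d=\lfloor D/2\rfloor$. For bipartite $\Gamma$ with $D\ge4$, $\theta_1^2>b_2>\theta_d^2$. Put $\tilde\theta_1=-1-b_2b_3(\theta_1^2-b_2)^{-1}$ and $\tilde\theta_d=-1-b_2b_3(\theta_d^2-b_2)^{-1}$. Taut: it is known that $$b_3\bigl(b_2(k-2)-(c_2-1)\theta_1^2\bigr)\bigl(b_2(k-2)-(c_2-1)\theta_d^2\bigr)\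 \ge\ b_1\Delta(\theta_1^2-b_2)(b_2-\theta_d^2),$$ with every factor nonnegative. $\Gamma$ is called taut if $\Delta\ne0$ and equality holds in this inequality. Let $V=\mathbb C^X$. For $x\in X$, $E_i^*=E_i^*(x)$ is the diagonal matrix in $\mathrm{Mat}_X(\mathbb C)$ with $(y,y)$ entry $1$ if $\partial(x,y)=i$ and $0$ otherwise. $T=T(x)$ is the subalgebra of $\mathrm{Mat}_X(\mathbb C)$ generated by $A,E_0^*,\ldots,E_D^*$. A $T$-module is a subspace $W\subseteq V$ with $BW\subseteq W$ for all $B\in T$; it is irreducible if it is nonzero and contains no $T$-modules other than $0$ and $W$. The endpoint of an irreducible $W$ is $\min\{i:E_i^*W\ne0\}$; $W$ is thin if $\dim E_i^*W\le1$ for $0\le i\le D$. If $W$ is thin irreducible with endpoint $2$, then $E_2^*W$ is a one-dimensional eigenspace for $E_2^*A_2E_2^*$; the corresponding eigenvalue is the local eigenvalue of $W$. Taut with respect to a vertex ($D$ odd): $\Gamma$ is taut with respect to $x$ if every irreducible $T(x)$-module with endpoint $2$ is thin with local eigenvalue $\tilde\theta_1$ or $\tilde\theta_d$. *)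

(* Defs.v *)
From HB Require Import structures.
From mathcomp Require Import all_boot all_order all_algebra.

Set Implicit Arguments.
Unset Strict Implicit.
Unset Printing Implicit Defensive.

Import Order.TTheory GRing.Theory Num.Theory.
Local Open Scope ring_scope.

Section Graph.
Variables (X : finType) (e : rel X).

Definition simple_connected_graph : Prop :=
  [/\ symmetric e, irreflexive e & forall x y : X, connect e x y].

Definition has_walk (n : nat) (x y : X) : bool :=
  [exists p : n.-tuple X, path e x p && (last x p == y)].

(* Least length of a walk from x to y. In a connected graph this is always
   less than #|X|, which is the junk value otherwise. *)
Definition dist (x y : X) : nat :=
  find (fun n => has_walk n x y) (iota 0 #|X|).

Definition diameter : nat := \max_(x : X) \max_(y : X) dist x y.

Definition bipartite : Prop :=
  exists P : {set X}, forall x y : X, e x y -> (x \in P) != (y \in P).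

Definition count_dist (i j : nat) (x y : X) : nat :=
  #|[set z : X | (dist x z == i) && (dist z y == j)]|.

Definition distance_regular : Prop :=
  forall h i j : nat,
    (h <= diameter)%N -> (i <= diameter)%N -> (j <= diameter)%N ->
  forall x y x' y' : X, dist x y = h -> dist x' y' = h ->
    count_dist i j x y = count_dist i j x' y'.

(* p^h_{ij}, read off from an arbitrary pair at distance h; this is
   well defined only when the graph is distance-regular. *)
Definition pnum (h i j : nat) : nat :=
  if [pick q : X * X | dist q.1 q.2 == h] is Some q
  then count_dist i j q.1 q.2 else 0%N.

Definition cnum (i : nat) : nat := pnum i 1 i.-1.
Definition bnum (i : nat) : nat := pnum i 1 i.+1.
Definition valency : nat := bnum 0.

End Graph.

Section Eigenvalues.
Variables (C : numClosedFieldType) (n : nat).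

(* The distinct eigenvalues, in decreasing order when they are all real (the
   order of a numClosedFieldType is only partial). *)
Definition eigenvalues (M : 'M[C]_n) : seq C :=
  sort >=%R (undup (sval (closed_field_poly_normal (char_poly M)))).

Lemma mem_eigenvalues (M : 'M[C]_n) (a : C) :
  (a \in eigenvalues M) = eigenvalue M a.
Proof.
rewrite /eigenvalues mem_sort mem_undup eigenvalue_root_char.
case: closed_field_poly_normal => r /= ->.
by rewrite (monicP (char_poly_monic M)) scale1r root_prod_XsubC.
Qed.

Lemma uniq_eigenvalues (M : 'M[C]_n) : uniq (eigenvalues M).
Proof. by rewrite sort_uniq undup_uniq. Qed.

End Eigenvalues.

(* Matrices over X are indexed through the enumeration of X, so that the
   row (or column) of the vertex x is the one of index enum_rank x. *)
Section Terwilliger.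
Variables (C : numClosedFieldType) (X : finType) (e : rel X).

Local Notation MatX := 'M[C]_#|X|.
Local Notation V := 'cV[C]_#|X|.

Definition distmx (i : nat) : MatX :=
  \matrix_(y, z) (dist e (enum_val y) (enum_val z) == i)%:R.

Definition adjmx : MatX := distmx 1.

Definition dual_idem (x : X) (i : nat) : MatX :=
  \matrix_(y, z) ((y == z) && (dist e x (enum_val y) == i))%:R.

Inductive Talg (x : X) : MatX -> Prop :=
| Talg_adj : Talg x adjmx
| Talg_dual i of (i <= diameter e)%N : Talg x (dual_idem x i)
| Talg_one : Talg x 1%:M
| Talg_scale a M of Talg x M : Talg x (a *: M)
| Talg_add M N of Talg x M & Talg x N : Talg x (M + N)
| Talg_mul M N of Talg x M & Talg x N : Talg x (M *m N).

Definition Tmodule (x : X) (W : {vspace V}) : Prop :=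
  forall B : MatX, Talg x B -> forall w : V, w \in W -> B *m w \in W.

Definition Tirreducible (x : X) (W : {vspace V}) : Prop :=
  [/\ Tmodule x W, W != 0%VS &
      forall U : {vspace V}, Tmodule x U -> (U <= W)%VS ->
        U = 0%VS \/ U = W].

Definition dual_part (x : X) (i : nat) (W : {vspace V}) : {vspace V} :=
  (linfun (mulmx (dual_idem x i)) @: W)%VS.

Definition endpoint (x : X) (W : {vspace V}) : nat :=
  find (fun i => dual_part x i W != 0%VS) (iota 0 (diameter e).+1).

Definition thin (x : X) (W : {vspace V}) : Prop :=
  forall i : nat, (i <= diameter e)%N -> (\dim (dual_part x i W) <= 1)%N.

(* Meant for thin irreducible W of endpoint 2: then dual_part x 2 W is a line
   and a is uniquely determined. *)
Definition local_eigenvalue (x : X) (W : {vspace V}) (a : C) : Prop :=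
  forall w : V, w \in dual_part x 2 W ->
    (dual_idem x 2 *m distmx 2 *m dual_idem x 2) *m w = a *: w.

Definition theta (i : nat) : C := (eigenvalues adjmx)`_i.

Local Notation D := (diameter e).
Local Notation d := (D./2).
Local Notation b i := ((bnum e i)%:R : C).
Local Notation c i := ((cnum e i)%:R : C).
Local Notation k := ((valency e)%:R : C).

Definition Delta : C :=
  (k - 2) * (c 3 - 1) - (c 2 - 1) * (pnum e 2 2 2)%:R.

Definition theta_tilde (i : nat) : C :=
  - 1 - b 2 * b 3 * (theta i ^+ 2 - b 2)^-1.

Definition taut : Prop :=
  Delta != 0 /\
  b 3 * (b 2 * (k - 2) - (c 2 - 1) * theta 1 ^+ 2)
      * (b 2 * (k - 2) - (c 2 - 1) * theta d ^+ 2)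
  = b 1 * Delta * (theta 1 ^+ 2 - b 2) * (b 2 - theta d ^+ 2).

(* Only for odd diameter: tautness with respect to a vertex is defined
   differently for even diameter. *)
Definition taut_wrt (x : X) : Prop :=
  forall W : {vspace V}, Tirreducible x W -> endpoint x W = 2 ->
    thin x W /\ (local_eigenvalue x W (theta_tilde 1) \/
                 local_eigenvalue x W (theta_tilde d)).

End Terwilliger.

(* Main.v *)
Require Import Defs.
From mathcomp Require Import all_boot all_order all_algebra.
From mathcomp Require boolp.
From mathcomp Require Import reals complex.
From mathcomp Require Import zify ring.

Set Implicit Arguments.
Unset Strict Implicit.
Unset Printing Implicit Defensive.

Import Order.TTheory GRing.Theory Num.Theory.
Local Open Scope ring_scope.

(** Fix a vertex [x]. Let [E i] be the projection onto the vertices at distance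
    [i] from [x], let [B = E 2 A_2 E 2], and let [U] ([local_space]) be the space
    of the vectors on level 2 that are killed by [E 1 A]. Write [alpha] and [beta]
    for [theta_tilde 1] and [theta_tilde d]. The equality that defines tautness
    turns out to be equivalent to [(B - alpha)(B - beta) = 0] on [U], for any one
    vertex [x] ([taut_criterion]); as the equality does not mention [x], the
    passage between one vertex and all vertices is then free.

    Bounds. For an eigenvalue [theta] with cosine sequence [s], the matrix
    [S = sum_j s_j A_j] is a positive multiple of the orthogonal projection onto
    the eigenspace ([cosine_matrix_sqr]), and for [v] in [U] the level 2 part of
    [S v] is [(s_2 - s_4)(B - tilde theta) v]. So [<v, (B - tilde theta) v>] has
    the sign of [s_2 - s_4] or vanishes, and it vanishes exactly when [S v = 0]
    ([local_bound]). This gives [alpha <= B <= beta] on [U], hence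
    [(B - alpha)(B - beta) <= 0] there, and this form is zero if and only if its
    trace is ([local_product_le0], [trace_local_product_eq0]). The orthogonal
    complement of [U] in level 2 is the image of [E 2 A E 1], on which [B] is
    explicit, so the trace is a rational expression in the intersection numbers,
    [alpha] and [beta]. It is a nonzero multiple of the difference of the two
    sides of the taut equality ([trace_taut]).

    Signs. What is needed about [theta_1] and [theta_d] is that the gaps
    [s_i - s_(i+2)] are nonzero, with the right sign for [i = 2]. Let [e = 1] for
    [theta_1] and [e = -1] for [theta_d]. Then [e (theta^2 - A^2)(k^2 - A^2)] is
    positive semidefinite, because [theta_1] is the second largest eigenvalue and,
    [D] being odd, [theta_d] is the one of least absolute value. Testing this form
    on a truncated cosine sequence shows that [e] times the product of two gaps
    two steps apart is positive ([cosine_gap_sign]).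

    Modules. An irreducible module [W] of endpoint 2 has [E 2 W] inside [U]. If
    [(B - alpha)(B - beta)] kills [U], then [W] contains an eigenvector [v] of [B]
    for [alpha] or [beta], and [S v = 0] for the matching eigenvalue. Together with
    [J v = 0] this leaves one dimension on each level for the span of the
    components of the [A_j v], and this span is a module: [W] is thin
    ([thin_of_eigenvector]). Conversely [U] is orthogonal to the module generated
    by the levels 0 and 1 ([local_space_low]), so by complete reducibility [U]
    lies in a sum of irreducible modules without components on those levels, on
    which tautness at [x] makes [(B - alpha)(B - beta)] vanish. *)

(** * Distances in a connected graph *)

Section Distance.
Variables (X : finType) (e : rel X).
Hypothesis hgraph : simple_connected_graph e.

Local Notation dist := (dist e).
Local Notation D := (diameter e).

Lemma has_walkP n x y :
  reflect (exists p, [/\ size p = n, path e x p & last x p = y])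
          (has_walk e n x y).
Proof.
apply: (iffP existsP) => [[p /andP[pp /eqP lp]]|[p [sp pp lp]]].
  by exists p; rewrite size_tuple.
by exists (Tuple (introT eqP sp)); rewrite /= pp lp eqxx.
Qed.

(** Loops can be removed from a walk, so the search in the definition of [dist]
    always succeeds. *)
Lemma has_short_walk x y : has (fun n => has_walk e n x y) (iota 0 #|X|).
Proof.
have [_ _ /(_ x y)/connectP[p pp ->]] := hgraph.
case: (shortenP pp) => p' pp' up' _.
apply/hasP; exists (size p'); last by apply/has_walkP; exists p'.
by rewrite mem_iota /= add0n -ltnS -[(size p').+1]/(size (x :: p')) -(card_uniqP up') ltnS max_card.
Qed.

Lemma dist_lt_card x y : (dist x y < #|X|)%N.
Proof. by have := has_short_walk x y; rewrite has_find size_iota. Qed.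

Lemma dist_walk x y : has_walk e (dist x y) x y.
Proof.
have := nth_find 0 (has_short_walk x y).
by rewrite nth_iota // dist_lt_card.
Qed.

Lemma dist_le_walk n x y : has_walk e n x y -> (dist x y <= n)%N.
Proof.
move=> wn; rewrite leqNgt; apply/negP => ltn.
have := before_find 0%N ltn.
by rewrite nth_iota ?wn // (ltn_trans ltn (dist_lt_card x y)).
Qed.

Lemma dist0P x y : reflect (x = y) (dist x y == 0%N).
Proof.
apply: (iffP eqP) => [d0|->].
  have : has_walk e 0 x y by rewrite -d0 dist_walk.
  by case/has_walkP => p [/size0nil -> _ <-].
by apply/eqP; rewrite -leqn0 dist_le_walk //; apply/has_walkP; exists [::].
Qed.

Lemma distxx x : dist x x = 0%N. Proof. exact/eqP/dist0P. Qed.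

Lemma dist_triangle y x z : (dist x z <= dist x y + dist y z)%N.
Proof.
have /has_walkP[p [<- pp lp]] := dist_walk x y.
have /has_walkP[q [<- pq lq]] := dist_walk y z.
apply/dist_le_walk/has_walkP; exists (p ++ q).
by rewrite size_cat cat_path last_cat lp pp.
Qed.

Lemma dist_sym x y : dist x y = dist y x.
Proof.
have [esym _ _] := hgraph.
wlog suff: x y / (dist x y <= dist y x)%N.
  by move=> H; apply/eqP; rewrite eqn_leq !H.
have /has_walkP[p [sp pp lp]] := dist_walk y x.
rewrite -sp -(size_belast y) -size_rev.
apply/dist_le_walk/has_walkP; exists (rev (belast y p)); split=> //.
  by rewrite -lp rev_path (eq_path (e' := e)) // => u v; rewrite esym.
by case: p {pp sp} lp => [/= ->//|z p _]; rewrite /= rev_cons last_rcons.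
Qed.

Lemma dist1E x y : (dist x y == 1%N) = e x y.
Proof.
have [_ eirr _] := hgraph.
apply/eqP/idP => [d1|exy].
  have : has_walk e 1 x y by rewrite -d1 dist_walk.
  by case/has_walkP => -[|z [|u p]] [] //= _ /andP[exz _] <-.
apply/eqP; rewrite eqn_leq lt0n; apply/andP; split.
  by apply/dist_le_walk/has_walkP; exists [:: y]; rewrite /= exy.
by apply/dist0P => xy; rewrite xy eirr in exy.
Qed.

(** The first step of a geodesic. *)
Lemma dist_step n x y : dist x y = n.+1 ->
  exists2 z, dist x z = 1%N & dist z y = n.
Proof.
move=> dxy; have := dist_walk x y; rewrite dxy.
case/has_walkP=> -[[]//|z p] [/= [sp]] /andP[exz pp] lp.
exists z; first by apply/eqP; rewrite dist1E.
have le1 : (dist z y <= n)%N by apply/dist_le_walk/has_walkP; exists p.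
have := dist_triangle z x y; rewrite dxy.
have /eqP -> : dist x z == 1%N by rewrite dist1E.
lia.
Qed.

Lemma dist_le_diam x y : (dist x y <= D)%N.
Proof.
by rewrite (leq_trans _ (leq_bigmax (F := fun x => \max_y dist x y) x)) //
  (leq_bigmax (F := dist x) y).
Qed.

Lemma dist_realized i : (0 < D)%N -> (i <= D)%N -> exists x y, dist x y = i.
Proof.
move=> D0 iD.
have : exists x y, dist x y = D.
  have X0 : (0 < #|X|)%N.
    rewrite lt0n; apply/eqP => X0; move: D0; rewrite /diameter big_pred0 // => x.
    by have := card0_eq X0 x.
  have [x xE] := @bigop.eq_bigmax _ (fun x => \max_y dist x y) X0.
  by have [y yE] := @bigop.eq_bigmax _ (dist x) X0; exists x, y; rewrite -yE -xE.
case=> x [y]; move: x; rewrite -(subnK iD).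
elim: (D - i)%N => [|m IHm] x dxy; first by exists x, y.
by have [z _ dzy] := dist_step dxy; apply: (IHm z).
Qed.

Lemma dist_adj_le x y z : dist x y = 1%N ->
  (dist x z <= (dist y z).+1)%N /\ (dist y z <= (dist x z).+1)%N.
Proof.
move=> xy; split; first by rewrite -addn1 addnC -xy dist_triangle.
by rewrite -addn1 addnC -xy (dist_sym x y) dist_triangle.
Qed.

Hypothesis hbip : bipartite e.

Lemma odd_dist_add x y z : odd (dist x z) = odd (dist x y) (+) odd (dist y z).
Proof.
have [P hP] := hbip.
have par u v : odd (dist u v) = (u \in P) (+) (v \in P).
  have /has_walkP[p [<- pp <-]] := dist_walk u v.
  elim: p u pp => [|w p IH] u /=; first by rewrite addbb.
  case/andP=> /hP euw /IH ->.
  by case: (u \in P) euw; case: (w \in P); case: (last w p \in P).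
by rewrite !par; case: (x \in P); case: (y \in P); case: (z \in P).
Qed.

Lemma dist_adj x y z : dist x y = 1%N ->
  dist x z = (dist y z).+1 \/ dist y z = (dist x z).+1.
Proof.
move=> xy; have [le1 le2] := dist_adj_le z xy.
have := odd_dist_add x y z; rewrite xy /=; lia.
Qed.

End Distance.

(** * Intersection numbers *)

Definition bipartite_drg (X : finType) (e : rel X) : Prop :=
  [/\ simple_connected_graph e, bipartite e, distance_regular e
    & (4 <= diameter e)%N].

Section IntersectionNumbers.
Variables (C : numClosedFieldType) (X : finType) (e : rel X).
Hypothesis hG : bipartite_drg e.

Let hgraph : simple_connected_graph e. Proof. by case: hG. Qed.
Let hbip : bipartite e. Proof. by case: hG. Qed.
Let hdr : distance_regular e. Proof. by case: hG. Qed.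
Let hD : (4 <= diameter e)%N. Proof. by case: hG. Qed.

Local Notation dist := (dist e).
Local Notation D := (diameter e).
Local Notation b i := ((bnum e i)%:R : C).
Local Notation c i := ((cnum e i)%:R : C).
Local Notation k := ((valency e)%:R : C).

Lemma pnumE h i j x y : dist x y = h -> pnum e h i j = count_dist e i j x y.
Proof.
move=> <-.
rewrite /pnum; case: pickP => [q /eqP dq|/(_ (x, y))]; last by rewrite eqxx.
have [iD|Di] := leqP i D; last first.
  rewrite /count_dist !eq_card0 // => z; rewrite !inE; apply/negbTE/negP;
  by case/andP=> /eqP iE _; move: Di; rewrite -iE ltnNge dist_le_diam.
have [jD|Dj] := leqP j D; last first.
  rewrite /count_dist !eq_card0 // => z; rewrite !inE; apply/negbTE/negP;
  by case/andP=> _ /eqP jE; move: Dj; rewrite -jE ltnNge dist_le_diam.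
exact: (hdr (dist_le_diam e x y)).
Qed.

Lemma card_dist_sum i j x y :
  (count_dist e i j x y)%:R = \sum_(z | dist x z == i) (dist z y == j)%:R :> C.
Proof.
by rewrite -natr_sum /count_dist cardsE -sum1_card big_mkcondr.
Qed.

(** Every neighbour of a vertex is one step nearer to or one step farther from
    any given vertex; distance-regularity says how many there are of each. *)
Lemma sum_neighbours (w : nat -> C) x y :
  \sum_(z | dist x z == 1%N) w (dist z y) =
  c (dist x y) * w (dist x y).-1 + b (dist x y) * w (dist x y).+1.
Proof.
rewrite /cnum /bnum !(pnumE _ _ (erefl (dist x y))) !card_dist_sum !mulr_suml -big_split /=.
apply: eq_bigr => z /eqP xz.
have [->|->] := dist_adj hgraph hbip y xz.
  by rewrite eqxx (_ : _ == _.+2 = false) ?mul1r ?mul0r ?addr0 //; lia.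
by rewrite eqxx (_ : _ == _.-1 = false) ?mul1r ?mul0r ?add0r //; lia.
Qed.

Lemma diam_gt0 : (0 < D)%N. Proof. exact: leq_trans hD. Qed.

Lemma cnum0 : cnum e 0 = 0%N.
Proof.
have [x [y xy]] := dist_realized hgraph diam_gt0 (leq0n D).
rewrite /cnum (pnumE _ _ xy) /count_dist eq_card0 // => z; rewrite !inE.
apply/negbTE/negP => /andP[/eqP xz /(dist0P hgraph) zy]; subst z.
by rewrite xy in xz.
Qed.

Lemma cnum1 : cnum e 1 = 1%N.
Proof.
have [x [y xy]] := dist_realized hgraph diam_gt0 diam_gt0.
rewrite /cnum (pnumE _ _ xy) /count_dist (_ : [set _ | _] = [set y]) ?cards1 //.
apply/setP => z; rewrite !inE; apply/andP/eqP => [[_ /(dist0P hgraph)]//|->].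
by rewrite xy (distxx hgraph).
Qed.

Lemma bnum_diam : bnum e D = 0%N.
Proof.
have [x [y xy]] := dist_realized hgraph diam_gt0 (leqnn D).
rewrite /bnum (pnumE _ _ xy) /count_dist eq_card0 // => z; rewrite !inE.
apply/negbTE/negP => /andP[_ /eqP zy].
by have := dist_le_diam e z y; rewrite zy ltnn.
Qed.

Lemma cnum_gt0 i : (i < D)%N -> (0 < cnum e i.+1)%N.
Proof.
move=> iD; have [x [y xy]] := dist_realized hgraph diam_gt0 iD.
have [z xz zy] := dist_step hgraph xy.
rewrite /cnum (pnumE _ _ xy) card_gt0; apply/set0Pn; exists z.
by rewrite inE xz zy !eqxx.
Qed.

Lemma bnum_gt0 i : (i < D)%N -> (0 < bnum e i)%N.
Proof.
move=> iD; have [x [y xy]] := dist_realized hgraph diam_gt0 iD.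
have [z xz zy] := dist_step hgraph xy.
rewrite /bnum (pnumE _ _ zy) card_gt0; apply/set0Pn; exists x.
by rewrite inE (dist_sym hgraph z) xz xy !eqxx.
Qed.

Lemma degreeE x : \sum_(z | dist x z == 1%N) 1 = k.
Proof.
have := sum_neighbours (fun=> 1) x x.
by rewrite (distxx hgraph) cnum0 !mulr1 add0r.
Qed.

Lemma bnumE i : (i <= D)%N -> b i = k - c i.
Proof.
move=> iD; have [x [y xy]] := dist_realized hgraph diam_gt0 iD.
have := sum_neighbours (fun=> 1) x y.
by rewrite xy degreeE !mulr1 => ->; rewrite addrC addKr.
Qed.

Lemma cnum_diam : c D = k.
Proof.
have := bnumE (leqnn D).
by rewrite bnum_diam => /esym/eqP; rewrite subr_eq0 => /eqP.
Qed.

Lemma cnum_neq0 i : (0 < i <= D)%N -> c i != 0.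
Proof. by case: i => // i /cnum_gt0; rewrite pnatr_eq0 lt0n. Qed.

Lemma bnum_neq0 i : (i < D)%N -> b i != 0.
Proof. by move=> /bnum_gt0; rewrite pnatr_eq0 lt0n. Qed.

(** A common neighbour of two vertices at distance two stays one step closer
    when a geodesic is prolonged. *)
Lemma cnum23 : (cnum e 2 <= cnum e 3)%N.
Proof.
have [x [y xy]] := dist_realized hgraph diam_gt0 (ltnW hD).
have yx : dist y x = 3%N by rewrite (dist_sym hgraph).
have [z yz zx] := dist_step hgraph yx.
have zx' : dist x z = 2%N by rewrite (dist_sym hgraph).
rewrite /cnum (pnumE _ _ xy) (pnumE _ _ zx'); apply/subset_leq_card/subsetP => t.
rewrite !inE => /andP[/eqP xt /eqP tz]; rewrite xt /=.
have := dist_triangle hgraph t x y; have := dist_triangle hgraph z t y.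
rewrite xy xt tz (dist_sym hgraph z) yz; lia.
Qed.

End IntersectionNumbers.

(** * Matrices that depend on the distance *)

Section RadialMatrices.
Variables (C : numClosedFieldType) (X : finType) (e : rel X).
Hypothesis hG : bipartite_drg e.

Let hgraph : simple_connected_graph e. Proof. by case: hG. Qed.

Local Notation dist := (dist e).
Local Notation D := (diameter e).
Local Notation b i := ((bnum e i)%:R : C).
Local Notation c i := ((cnum e i)%:R : C).
Local Notation A := (adjmx C e).
Local Notation MatX := 'M[C]_#|X|.

(** The elements of the Bose-Mesner algebra, given by their coefficients on the
    distance matrices. *)
Definition radial (w : nat -> C) : MatX :=
  \matrix_(y, z) w (dist (enum_val y) (enum_val z)).

(** The action of the adjacency matrix on these coefficients; at [h = 0] the
    value [w 0.-1] is harmless because [c 0 = 0], and at [h = D] so is [w D.+1]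
    because [b D = 0]. *)
Definition radial_step (w : nat -> C) (h : nat) : C :=
  c h * w h.-1 + b h * w h.+1.

Lemma sum_enum_val (F : X -> C) : \sum_(i < #|X|) F (enum_val i) = \sum_x F x.
Proof.
rewrite [RHS](reindex (fun i : 'I_#|X| => enum_val i)) //.
exact/onW_bij/enum_val_bij.
Qed.

Lemma sum_enum_valP (P : pred X) (F : X -> C) :
  \sum_(i < #|X| | P (enum_val i)) F (enum_val i) = \sum_(x | P x) F x.
Proof.
rewrite [RHS](reindex (fun i : 'I_#|X| => enum_val i)) //.
exact/onW_bij/enum_val_bij.
Qed.

Lemma eq_radial w w' : (forall h, (h <= D)%N -> w h = w' h) ->
  radial w = radial w'.
Proof. by move=> ww'; apply/matrixP=> y z; rewrite !mxE ww' // dist_le_diam. Qed.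

Lemma radial_inj w w' : radial w = radial w' ->
  forall h, (h <= D)%N -> w h = w' h.
Proof.
move=> /matrixP ww' h hle.
have [x [y xy]] := dist_realized hgraph (diam_gt0 hG) hle.
by have := ww' (enum_rank x) (enum_rank y); rewrite !mxE !enum_rankK xy.
Qed.

Lemma radialD w w' : radial w + radial w' = radial (fun h => w h + w' h).
Proof. by apply/matrixP=> y z; rewrite !mxE. Qed.

Lemma radialZ a w : a *: radial w = radial (fun h => a * w h).
Proof. by apply/matrixP=> y z; rewrite !mxE. Qed.

Lemma radial_one : radial (fun h => (h == 0)%:R) = 1%:M.
Proof.
apply/matrixP=> y z; rewrite !mxE; congr (_%:R : C).
by congr nat_of_bool; apply/(dist0P hgraph)/eqP => [/enum_val_inj|->].
Qed.

Lemma tr_radial w : (radial w)^T = radial w.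
Proof. by apply/matrixP=> y z; rewrite !mxE (dist_sym hgraph). Qed.

Lemma adj_radial w : A *m radial w = radial (radial_step w).
Proof.
apply/matrixP=> y z; rewrite !mxE.
under eq_bigr do rewrite !mxE mulr_natl mulrb.
rewrite -big_mkcond /= (sum_enum_valP (fun t => dist (enum_val y) t == 1%N)
  (fun t => w (dist t (enum_val z)))) (sum_neighbours hG).
by [].
Qed.

Lemma distmxE j : distmx C e j = radial (fun h => (h == j)%:R).
Proof. by []. Qed.

Lemma distmx0 : distmx C e 0 = 1%:M.
Proof. exact: radial_one. Qed.

Lemma distmx_big j : (D < j)%N -> distmx C e j = 0.
Proof.
move=> Dj; apply/matrixP=> y z; rewrite !mxE.
by case: eqP => // dj; move: Dj; rewrite -dj ltnNge dist_le_diam.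
Qed.

Lemma adj_distmx j :
  A *m distmx C e j.+1 = b j *: distmx C e j + c j.+2 *: distmx C e j.+2.
Proof.
rewrite !distmxE adj_radial !radialZ radialD; apply: eq_radial => h hle.
rewrite /radial_step eqSS.
have -> : (h.-1 == j.+1) = (h == j.+2) by lia.
by rewrite addrC; congr (_ + _); case: eqP => [->//|]; rewrite !mulr0.
Qed.

Lemma tr_distmx j : (distmx C e j)^T = distmx C e j.
Proof. exact: tr_radial (fun h => (h == j)%:R). Qed.

Lemma radial_sum w : radial w = \sum_(j < D.+1) w j *: distmx C e j.
Proof.
apply/matrixP=> y z; rewrite summxE !mxE.
have hlt : (dist (enum_val y) (enum_val z) < D.+1)%N by rewrite ltnS dist_le_diam.
rewrite (bigD1 (Ordinal hlt)) //= !mxE eqxx mulr1 big1 ?addr0 // => j.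
by rewrite -val_eqE /= => jne; rewrite !mxE eq_sym (negbTE jne) mulr0.
Qed.

End RadialMatrices.

(** * Hermitian form and polynomials in a real symmetric matrix *)

Section HermitianForm.
Variables (C : numClosedFieldType) (n : nat).
Implicit Types (u v w : 'cV[C]_n) (M N P : 'M[C]_n).

Definition hdot u v : C := \sum_i (u i 0)^* * v i 0.

Lemma hdotDr u v w : hdot u (v + w) = hdot u v + hdot u w.
Proof. by rewrite -big_split; apply: eq_bigr => i _; rewrite mxE mulrDr. Qed.

Lemma hdotZr a u v : hdot u (a *: v) = a * hdot u v.
Proof. by rewrite mulr_sumr; apply: eq_bigr => i _; rewrite mxE mulrCA. Qed.

Lemma hdot_conj u v : (hdot u v)^* = hdot v u.
Proof.
rewrite rmorph_sum; apply: eq_bigr => i _.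
by rewrite rmorphM /= conjCK mulrC.
Qed.

Lemma hdotDl u v w : hdot (u + v) w = hdot u w + hdot v w.
Proof. by rewrite -hdot_conj hdotDr rmorphD /= !hdot_conj. Qed.

Lemma hdotZl a u v : hdot (a *: u) v = a^* * hdot u v.
Proof. by rewrite -hdot_conj hdotZr rmorphM /= hdot_conj. Qed.

Lemma hdot0r u : hdot u 0 = 0.
Proof. by rewrite -(scale0r 0) hdotZr mul0r. Qed.

Lemma hdot0l u : hdot 0 u = 0.
Proof. by rewrite -hdot_conj hdot0r conjC0. Qed.

Lemma hdotNr u v : hdot u (- v) = - hdot u v.
Proof. by rewrite -scaleN1r hdotZr mulN1r. Qed.

Lemma hdotBr u v w : hdot u (v - w) = hdot u v - hdot u w.
Proof. by rewrite hdotDr hdotNr. Qed.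

Lemma hdot_ge0 u : 0 <= hdot u u.
Proof. by apply: sumr_ge0 => i _; rewrite mulrC mul_conjC_ge0. Qed.

Lemma hdot_eq0 u : hdot u u = 0 -> u = 0.
Proof.
move/eqP; rewrite psumr_eq0 => [/allP u0|i _]; last by rewrite mulrC mul_conjC_ge0.
apply/matrixP=> i j; rewrite mxE ord1.
by have := u0 i (mem_index_enum _); rewrite mulrC mul_conjC_eq0 => /eqP.
Qed.

Lemma hdot_delta i v : hdot (delta_mx i 0) v = v i 0.
Proof.
rewrite /hdot (bigD1 i) //= mxE !eqxx conjC1 mul1r big1 ?addr0 // => j ji.
by rewrite mxE (negbTE ji) conjC0 mul0r.
Qed.

Definition selfadj M := forall u v, hdot u (M *m v) = hdot (M *m u) v.

Lemma adjointP M N : (forall i j, (M i j)^* = N j i) ->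
  forall u v, hdot u (N *m v) = hdot (M *m u) v.
Proof.
move=> MN u v; rewrite /hdot.
under eq_bigr do rewrite mxE mulr_sumr.
rewrite exchange_big; apply: eq_bigr => j _ /=.
rewrite mxE rmorph_sum mulr_suml; apply: eq_bigr => i _.
by rewrite rmorphM /= MN mulrA; congr (_ * _); rewrite mulrC.
Qed.

Lemma selfadj_real_sym M : M^T = M -> (forall i j, (M i j)^* = M i j) ->
  selfadj M.
Proof. by move=> Ms Mr; apply: adjointP => i j; rewrite Mr -{1}Ms mxE. Qed.

(** [shift_prod M s] is the value at [M] of the monic polynomial with list of
    roots [s]. *)
Definition shift_prod M (s : seq C) : 'M[C]_n :=
  foldr (fun a B => (M - a%:M) *m B) 1%:M s.

Section Spectral.
Variable M : 'M[C]_n.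
Hypothesis Msym : M^T = M.
Hypothesis Mreal : forall i j, (M i j)^* = M i j.

Local Notation P := (spectralmx M).
Local Notation d := (spectral_diag M).

Lemma real_sym_spectral : M = invmx P *m diag_mx d *m P.
Proof.
apply/orthomx_spectralP/hermitian_normalmx/realsym_hermsym; last first.
  by apply/mxOverP => i j; apply/CrealP.
by apply/is_hermitianmxP; rewrite expr0 scale1r map_mx_id ?Msym.
Qed.

Lemma eigenvalue_spectral j : eigenvalue M (d 0 j).
Proof.
have Pu := spectral_unit M.
apply/eigenvalueP; exists (row j P).
  rewrite -row_mul {2}real_sym_spectral !mulmxA mulmxV // mul1mx.
  by rewrite row_mul row_diag_mx -scalemxAl -rowE.
apply/eqP => Pj0; move: Pu; rewrite -row_free_unit => /row_freeP[B PB].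
have /matrixP/(_ 0 j)/eqP := congr1 (row j) PB.
by rewrite row_mul Pj0 mul0mx !mxE eqxx eq_sym oner_eq0.
Qed.

Lemma shift_prod_spectral s : shift_prod M s =
  invmx P *m diag_mx (\row_j \prod_(a <- s) (d 0 j - a)) *m P.
Proof.
have Pu := spectral_unit M.
elim: s => [|a s IHs] /=.
  rewrite (_ : diag_mx _ = 1%:M) ?mulmx1 ?mulVmx //.
  by apply/matrixP => i j; rewrite !mxE big_nil.
rewrite IHs {1}real_sym_spectral.
have -> : a%:M = invmx P *m a%:M *m P.
  by rewrite mul_mx_scalar -scalemxAl mulVmx // scalemx1.
rewrite -mulmxBl -mulmxBr !mulmxA mulmxK //; congr (_ *m _).
rewrite -!mulmxA; congr (_ *m _).
rewrite -diag_const_mx -raddfB mulmx_diag; congr diag_mx.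
by apply/rowP => j; rewrite !mxE big_cons.
Qed.

Lemma shift_prod_eq0 s : (forall a, eigenvalue M a -> a \in s) ->
  shift_prod M s = 0.
Proof.
move=> sP; rewrite shift_prod_spectral (_ : \row_j _ = 0) ?linear0 ?mulmx0 ?mul0mx //.
apply/rowP => j; rewrite !mxE; apply/eqP; rewrite prodf_seq_eq0; apply/hasP.
by exists (d 0 j); rewrite ?subrr //= sP ?eigenvalue_spectral.
Qed.

(** In an orthonormal basis of eigenvectors the form is a sum of squares weighted by
    the values of the polynomial on the spectrum. *)
Lemma shift_prod_psd s (eps : C) :
  (forall a, eigenvalue M a -> 0 <= eps * \prod_(r <- s) (a - r)) ->
  forall w, 0 <= eps * hdot w (shift_prod M s *m w) /\
    (hdot w (shift_prod M s *m w) = 0 -> eps != 0 ->  shift_prod M s *m w = 0).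
Proof.
move=> psd w; rewrite shift_prod_spectral.
set f := \row_j _; set z := P *m w.
have PP u v : hdot u (invmx P *m v) = hdot (P *m u) v.
  apply: adjointP => i j; rewrite invmx_unitary ?spectral_unitarymx //.
  by rewrite !mxE.
have fz : hdot w (invmx P *m diag_mx f *m P *m w) =
          \sum_j f 0 j * (z j 0 * (z j 0)^*).
  rewrite -!mulmxA PP; apply: eq_bigr => j _.
  by rewrite mul_diag_mx -/z; move: z => z; rewrite mxE mulrCA [_^* * _]mulrC.
have ge0 j : 0 <= eps * (f 0 j * (z j 0 * (z j 0)^*)).
  by rewrite mulrA mulr_ge0 ?mul_conjC_ge0 // mxE psd ?eigenvalue_spectral.
rewrite fz mulr_sumr; split; first by apply: sumr_ge0 => j _.
move=> /(congr1 ( *%R eps)); rewrite mulr0 mulr_sumr => /eqP.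
rewrite psumr_eq0 // => /allP z0 eps0.
rewrite -!mulmxA -/z (_ : diag_mx f *m z = 0) ?mulmx0 //.
clearbody z f; apply/colP => j; rewrite mul_diag_mx !mxE; apply/eqP.
have := z0 j (mem_index_enum _); rewrite /= mulf_eq0 (negbTE eps0) /= mulf_eq0.
by rewrite mul_conjC_eq0 mulf_eq0.
Qed.

Lemma eigenvalue_real_sym a : eigenvalue M a -> a^* = a.
Proof.
case/eigenvalueP => v va v0.
have vM : M *m v^T = a *: v^T by rewrite -{1}Msym -trmx_mul va linearZ.
have := selfadj_real_sym Msym Mreal v^T v^T; rewrite vM hdotZr hdotZl => /eqP.
rewrite -subr_eq0 -mulrBl mulf_eq0 subr_eq0 => /orP[/eqP //|/eqP /hdot_eq0 vT0].
by rewrite -(trmxK v) vT0 trmx0 eqxx in v0.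
Qed.

End Spectral.
End HermitianForm.

(** * Cosine sequences *)

Section Spectrum.
Variables (C : numClosedFieldType) (X : finType) (e : rel X).
Hypothesis hG : bipartite_drg e.

Let hgraph : simple_connected_graph e. Proof. by case: hG. Qed.

Local Notation dist := (dist e).
Local Notation D := (diameter e).
Local Notation b i := ((bnum e i)%:R : C).
Local Notation c i := ((cnum e i)%:R : C).
Local Notation k := ((valency e)%:R : C).
Local Notation A := (adjmx C e).
Local Notation radial := (@radial C X e).
Local Notation radial_step := (@radial_step C X e).

Lemma adj_sym : A^T = A.
Proof. exact: tr_distmx. Qed.

Lemma adj_real i j : (A i j)^* = A i j.
Proof. by rewrite !mxE conjC_nat. Qed.

(** Two consecutive cosines, [cosine t 0 = 1] and [cosine t 1 = t / k], continued
    by [t s_i = c_i s_(i-1) + b_i s_(i+1)]. *)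
Fixpoint cosine_pair (t : C) n : C * C :=
  if n is m.+1 then
    let p := cosine_pair t m in (p.2, (t * p.2 - c m.+1 * p.1) / b m.+1)
  else (1, t / k).

Definition cosine t n := (cosine_pair t n).1.

Lemma cosine_step t i : (i < D)%N -> radial_step (cosine t) i = t * cosine t i.
Proof.
move=> iD; have b0 := bnum_neq0 C hG iD; rewrite /radial_step.
case: i iD b0 => [|i] iD b0 /=.
  by rewrite (cnum0 hG) mul0r add0r /cosine /= mulr1 mulrC divfK.
by rewrite {2}/cosine /= mulrCA divff // mulr1 /cosine /= addrC subrK.
Qed.

Lemma cosine_real t : t^* = t -> forall n, (cosine t n)^* = cosine t n.
Proof.
move=> tr n; suff [] : (cosine_pair t n).1^* = (cosine_pair t n).1 /\
  (cosine_pair t n).2^* = (cosine_pair t n).2 by [].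
elim: n => [|n [IH1 IH2]] /=.
  by rewrite conjC1 rmorphM /= fmorphV /= tr conjC_nat.
by rewrite rmorphM /= fmorphV /= rmorphB /= !rmorphM /= tr IH1 IH2 !conjC_nat.
Qed.

(** The action of [A - a] on coefficients. *)
Definition radial_shift a w h := radial_step w h - a * w h.

Lemma adj_shift_radial a w : (A - a%:M) *m radial w = radial (radial_shift a w).
Proof.
rewrite mulmxBl (adj_radial hG) mul_scalar_mx -scaleN1r !radialZ radialD.
by apply: eq_radial => h _; rewrite mulN1r.
Qed.

Lemma eigenvectorP t :
  reflect (exists2 u : 'cV_#|X|, A *m u = t *: u & u != 0) (eigenvalue A t).
Proof.
apply: (iffP eigenvalueP) => [] [u ut u0].
  exists u^T; last by apply: contra u0 => /eqP u0; rewrite -(trmxK u) u0 trmx0.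
  by rewrite -{1}adj_sym -trmx_mul ut linearZ.
exists u^T; last by apply: contra u0 => /eqP u0; rewrite -(trmxK u) u0 trmx0.
by rewrite -{1}adj_sym -trmx_mul ut linearZ.
Qed.

Lemma vertex_exists : exists x0 : X, true.
Proof. by have [x _] := dist_realized hgraph (diam_gt0 hG) (leq0n D); exists x. Qed.

Lemma radial_eigen t w : w 0%N != 0 ->
  (forall h, (h <= D)%N -> radial_step w h = t * w h) -> eigenvalue A t.
Proof.
move=> w0 wt; have [x _] := vertex_exists.
apply/eigenvectorP; exists (radial w *m delta_mx (enum_rank x) 0).
  by rewrite mulmxA (adj_radial hG) scalemxAl radialZ (eq_radial wt).
apply/eqP => /matrixP/(_ (enum_rank x) 0); rewrite -colE !mxE.
by rewrite (distxx hgraph) => /eqP; rewrite (negbTE w0).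
Qed.

Lemma eigenvalue_valency : eigenvalue A k.
Proof.
apply: (@radial_eigen k (fun=> 1)); first exact: oner_neq0.
by move=> h hD'; rewrite /radial_step (bnumE C hG) // !mulr1 addrC subrK.
Qed.

(** The boundary equation of the cosine recurrence holds at an eigenvalue:
    otherwise the last distance matrix, hence by the downward recurrence every
    distance matrix, would kill the eigenvector. *)
Lemma cosine_end t : eigenvalue A t -> radial_step (cosine t) D = t * cosine t D.
Proof.
case/eigenvectorP => u ut u0; set xi := radial_shift t (cosine t) D.
have : (A - t%:M) *m radial (cosine t) = xi *: distmx C e D.
  rewrite adj_shift_radial distmxE radialZ; apply: eq_radial => h hD'.
  have [->|hne] := eqVneq h D; first by rewrite mulr1.
  by rewrite mulr0 /radial_shift cosine_step ?subrr // ltn_neqAle hne.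
move/(congr1 trmx); rewrite trmx_mul linearZ /= (tr_distmx C hG) (tr_radial hG).
rewrite linearB /= adj_sym tr_scalar_mx => /(congr1 (mulmx^~ u)).
rewrite -mulmxA mulmxBl ut mul_scalar_mx subrr mulmx0 -scalemxAl => /esym/eqP.
rewrite scaler_eq0 => /orP[|/eqP Du0].
  by rewrite subr_eq0 => /eqP.
have down m : (m <= D)%N -> distmx C e (D - m) *m u = 0 /\
                            distmx C e (D - m).+1 *m u = 0.
  elim: m => [_|m IHm mD].
    by rewrite subn0 Du0 distmx_big // mul0mx.
  have [IH1 IH2] := IHm (ltnW mD).
  have E : (D - m)%N = (D - m.+1).+1 by rewrite -subSn // subSS.
  rewrite E in IH1 IH2; split=> //.
  have := congr1 (mulmx^~ u) (adj_distmx C hG (D - m.+1)).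
  rewrite -mulmxA IH1 mulmx0 mulmxDl -!scalemxAl IH2 scaler0 addr0 => /esym/eqP.
  rewrite scaler_eq0 (negbTE (bnum_neq0 C hG _)) ?E; last by lia.
  by move=> /eqP.
have [] := down D (leqnn D).
by rewrite subnn distmxE (radial_one C hG) mul1mx => u0'; rewrite u0' eqxx in u0.
Qed.

Lemma cosine_stepE t : eigenvalue A t ->
  forall h, (h <= D)%N -> radial_step (cosine t) h = t * cosine t h.
Proof.
move=> et h; rewrite leq_eqVlt => /orP[/eqP ->|]; first exact: cosine_end.
exact: cosine_step.
Qed.

Lemma adj_cosine t : eigenvalue A t ->
  A *m radial (cosine t) = t *: radial (cosine t).
Proof.
move=> et; rewrite (adj_radial hG) radialZ.
by apply: eq_radial; apply: cosine_stepE.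
Qed.

(** Bipartiteness makes the spectrum symmetric: alternate the signs of the
    cosines. *)
Lemma eigenvalueN t : eigenvalue A t -> eigenvalue A (- t).
Proof.
move=> et; apply: (@radial_eigen _ (fun h => (-1) ^+ h * cosine t h)).
  by rewrite mul1r oner_neq0.
move=> [|h] hle.
  have := cosine_stepE et hle; rewrite /radial_step (cnum0 hG) !mul0r !add0r.
  by rewrite expr1 expr0 mul1r !mulN1r mulrN mulNr => ->.
have := cosine_stepE et hle; rewrite /radial_step /= => tE.
rewrite !exprS /= [RHS](_ : _ = (-1) ^+ h * (t * cosine t h.+1)); last by ring.
by rewrite -tE; ring.
Qed.

(** For [t > k] the cosine sequence would increase strictly, against its boundary
    equation [t s_D = k s_(D-1)]. *)
Lemma eigenvalue_le_valency t : eigenvalue A t -> t <= k.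
Proof.
move=> et; have /CrealP tr := eigenvalue_real_sym adj_sym adj_real et.
have kt : k \is Num.real by rewrite realn.
have [//|kt'] := real_leP tr kt.
have pos n : (n < D)%N -> 0 < cosine t n < cosine t n.+1.
  elim: n => [|n IHn] nD.
    rewrite /cosine /= ltr01 /= ltr_pdivlMr ?mul1r //.
    by rewrite ltr0n (bnum_gt0 hG) ?(diam_gt0 hG).
  have /andP[n0 lt_n] := IHn (ltnW nD).
  have n1 := lt_trans n0 lt_n; rewrite n1 /=.
  have b0 : 0 < b n.+1 by rewrite ltr0n (bnum_gt0 hG).
  have := cosine_step t nD; rewrite /radial_step /= => tE.
  rewrite -(ltr_pM2l b0) (_ : _ * cosine t n.+2 = t * cosine t n.+1 - c n.+1 * cosine t n).
    rewrite (bnumE C hG (ltnW nD)) mulrBl ltrB //; first by rewrite ltr_pM2r.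
    by rewrite ltr_pM2l // ltr0n (cnum_gt0 hG) // ltnW.
  by rewrite -tE addrC addKr.
have := cosine_end et; rewrite /radial_step (bnum_diam hG) mul0r addr0 (cnum_diam C hG).
have D1 : (D.-1 < D)%N by rewrite prednK ?(diam_gt0 hG).
have /andP[n0] := pos _ D1; rewrite prednK ?(diam_gt0 hG) // => lt1 tE.
have : k * cosine t D.-1 < t * cosine t D.
  apply: lt_trans (_ : k * cosine t D < _).
    by rewrite ltr_pM2l // ltr0n (bnum_gt0 hG) // (diam_gt0 hG).
  by rewrite ltr_pM2r // (lt_trans n0).
by rewrite tE ltxx.
Qed.

End Spectrum.

(** * The distinct eigenvalues *)

Section Extremal.
Variables (C : numClosedFieldType) (X : finType) (e : rel X).
Hypothesis hG : bipartite_drg e.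

Let hD : (4 <= diameter e)%N. Proof. by case: hG. Qed.

Local Notation dist := (dist e).
Local Notation D := (diameter e).
Local Notation b i := ((bnum e i)%:R : C).
Local Notation c i := ((cnum e i)%:R : C).
Local Notation k := ((valency e)%:R : C).
Local Notation A := (adjmx C e).
Local Notation radial := (@radial C X e).
Local Notation radial_step := (@radial_step C X e).
Local Notation radial_shift := (@radial_shift C X e).
Local Notation cosine := (@cosine C X e).
Local Notation theta := (theta C e).

Lemma shift_prod_radial s w :
  shift_prod A s *m radial w = radial (foldr radial_shift w s).
Proof.
elim: s => [|a s IHs] /=; first by rewrite mul1mx.
by rewrite -mulmxA IHs (adj_shift_radial hG).
Qed.

(** A product of fewer than [D.+1] factors [A - a] still has a nonzero entry,
    at two vertices whose distance is the number of factors. *)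
Lemma diam_lt_eigenvalues : (D < size (eigenvalues A))%N.
Proof.
rewrite ltnNge; apply/negP => sD.
pose w s := foldr radial_shift (fun h => (h == 0)%:R) s.
have wS a s : w (a :: s) = radial_shift a (w s) by [].
have wP s : (forall h, (size s < h)%N -> w s h = 0) /\
            ((size s <= D)%N -> w s (size s) != 0).
  elim: s => [|a s [IH1 IH2]]; first by split=> [h /= h0|_ /=]; rewrite ?gtn_eqF ?oner_neq0.
  split=> [h|]; rewrite wS -[size (a :: s)]/(size s).+1 => sD'.
    rewrite /radial_shift /radial_step (IH1 h.-1) ?(IH1 h) ?(IH1 h.+1) //; try lia.
    by rewrite !mulr0 addr0 subr0.
  rewrite /radial_shift /radial_step (IH1 (size s).+2) // (IH1 (size s).+1) //=.
  by rewrite !mulr0 subr0 addr0 mulf_neq0 ?IH2 ?(cnum_neq0 C hG) // ltnW.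
have [_ /(_ sD) /eqP[]] := wP (eigenvalues A).
have : radial (w (eigenvalues A)) = radial (fun=> 0).
  rewrite -shift_prod_radial shift_prod_eq0 ?mul0mx.
  - by apply/matrixP=> i j; rewrite !mxE.
  - exact: (adj_sym _ hG).
  - exact: adj_real.
  - by move=> a; rewrite mem_eigenvalues.
by move/(radial_inj hG); apply.
Qed.

(** The cosine sequences are eigenvectors of a tridiagonal matrix of order
    [D.+1]. *)
Lemma eigenvalues_le_diam : (size (eigenvalues A) <= D.+1)%N.
Proof.
pose T : 'M[C]_D.+1 := \matrix_(i, j)
  (c i * (j == i.-1 :> nat)%:R + b i * (j == i.+1 :> nat)%:R).
have pick (f : nat -> C) m a : (forall j, (j == m) && (D < j)%N -> a = 0) ->
    \sum_(j < D.+1) a * (j == m :> nat)%:R * f j = a * f m.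
  move=> aP; have [mD|Dm] := ltnP m D.+1.
    rewrite (bigD1 (Ordinal mD)) //= eqxx mulr1 big1 ?addr0 // => j.
    by rewrite -val_eqE /= => /negbTE ->; rewrite mulr0 mul0r.
  by rewrite (aP m) ?eqxx // mul0r big1 // => j _; rewrite !mul0r.
have TE t : eigenvalue A t -> T *m (\col_i cosine t i) = t *: \col_i cosine t i.
  move=> et; apply/colP => i; rewrite !mxE -(cosine_stepE hG et); last by rewrite -ltnS.
  under eq_bigr do rewrite !mxE mulrDl.
  rewrite big_split /= !pick // => j /andP[/eqP ->].
    move=> iD; have -> : i = D :> nat by apply/eqP; rewrite eqn_leq -ltnS ltn_ord -ltnS.
    by rewrite (bnum_diam hG).
  by move=> iD; exfalso; have := ltn_ord i; lia.
have ev t : t \in eigenvalues A -> root (char_poly T^T) t.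
  rewrite mem_eigenvalues -eigenvalue_root_char => /TE Tt.
  apply/eigenvalueP; exists (\col_i cosine t i)^T.
    by rewrite -trmx_mul Tt linearZ.
  by apply/eqP => /rowP/(_ 0)/eqP; rewrite !mxE oner_eq0.
rewrite -ltnS -(size_char_poly T^T); apply: max_poly_roots.
- by rewrite monic_neq0 ?char_poly_monic.
- by apply/allP => t /ev.
- exact: uniq_eigenvalues.
Qed.

Lemma size_eigenvalues : size (eigenvalues A) = D.+1.
Proof. by apply/eqP; rewrite eqn_leq eigenvalues_le_diam diam_lt_eigenvalues. Qed.

Lemma eigenvalue_theta i : (i <= D)%N -> eigenvalue A (theta i).
Proof. by move=> iD; rewrite -mem_eigenvalues mem_nth // size_eigenvalues. Qed.

Lemma thetaP t : eigenvalue A t -> exists2 i, (i <= D)%N & t = theta i.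
Proof.
rewrite -mem_eigenvalues => te; exists (index t (eigenvalues A)).
  by rewrite -ltnS -size_eigenvalues index_mem.
by rewrite /theta nth_index.
Qed.

Lemma eigenvalue_adj_real t : eigenvalue A t -> t \is Num.real.
Proof. by move=> /(eigenvalue_real_sym (adj_sym C hG) (@adj_real C X e))/CrealP. Qed.

Lemma eigenvalues_sorted : sorted >%R (eigenvalues A).
Proof.
have : sorted >=%R (eigenvalues A).
  apply: (sort_sorted_in (P := Num.real)).
    by move=> x y xr yr /=; rewrite real_leVge.
  apply/allP => x; rewrite -(mem_sort >=%R) => xe.
  by apply: eigenvalue_adj_real; rewrite -mem_eigenvalues.
have := uniq_eigenvalues A; elim: (eigenvalues A) => // x [//|y s] IH /=.
case/andP; rewrite inE negb_or => /andP[xy _] us /andP[yx sy].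
by rewrite lt_neqAle eq_sym xy yx /=; apply: IH.
Qed.

Lemma theta_lt i j : (i < j)%N -> (j <= D)%N -> theta j < theta i.
Proof.
move=> ij jD.
by apply: (sorted_ltn_nth _ _ eigenvalues_sorted);
  rewrite ?inE ?size_eigenvalues ?ltnS // ?(leq_trans (ltnW ij)) // => y x z /= yx zy;
  exact: lt_trans zy yx.
Qed.

Lemma theta_le i j : (i <= j)%N -> (j <= D)%N -> theta j <= theta i.
Proof.
rewrite leq_eqVlt => /orP[/eqP -> _ //|ij jD]; exact/ltW/theta_lt.
Qed.

(** The spectrum is symmetric and listed in decreasing order, so negation reverses
    the list. *)
Lemma thetaN i : (i <= D)%N -> theta (D - i) = - theta i.
Proof.
move=> iD; have rE : eigenvalues A = map -%R (rev (eigenvalues A)).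
  apply: (irr_sorted_eq (leT := >%R)).
  - by move=> y x z /= yx zy; exact: lt_trans zy yx.
  - by move=> x; rewrite /= ltxx.
  - exact: eigenvalues_sorted.
  - rewrite sorted_map rev_sorted (eq_sorted (e' := >%R)) ?eigenvalues_sorted //.
    by move=> x y /=; rewrite ltrN2.
  - move=> t; rewrite -{2}[t]opprK (mem_map (@oppr_inj C)) mem_rev !mem_eigenvalues.
    apply/idP/idP => /(eigenvalueN hG) //; by rewrite opprK.
rewrite /theta {1}rE (nth_map 0) ?size_rev ?size_eigenvalues ?ltnS ?leq_subr //.
by rewrite nth_rev ?size_eigenvalues ?ltnS ?leq_subr // subSS subKn.
Qed.

Lemma theta0 : theta 0 = k.
Proof.
have [i iD kE] := thetaP (eigenvalue_valency C hG).
apply: le_anti; rewrite (eigenvalue_le_valency hG) ?eigenvalue_theta //.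
by rewrite kE theta_le.
Qed.

Hypothesis hodd : odd D.
Local Notation d := (D./2).

Lemma sqr_theta_lt i : (0 < i)%N -> (i < D)%N -> theta i ^+ 2 < k ^+ 2.
Proof.
move=> i0 iD; rewrite -subr_gt0 subr_sqr mulr_gt0 //.
  by rewrite subr_gt0 -theta0 theta_lt // ltnW.
rewrite -[X in _ + X]opprK subr_gt0 -(thetaN (ltnW iD)) -theta0.
by rewrite theta_lt //; lia.
Qed.

(** With [D] odd there are [D.+1 = 2 (d + 1)] eigenvalues, so that [theta d] and
    [theta d.+1 = - theta d] are the two in the middle. *)
Lemma theta_half_gt0 : 0 < theta d.
Proof.
have := @theta_lt d d.+1 (leqnn _).
have -> : d.+1 = (D - d)%N by lia.
rewrite thetaN; last by lia.
by move=> /(_ (leq_subr _ _)); rewrite -subr_gt0 opprK -mulr2n pmulrn_lgt0.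
Qed.

Lemma theta_half_le t : eigenvalue A t -> theta d ^+ 2 <= t ^+ 2.
Proof.
have main i : (i <= d)%N -> theta d ^+ 2 <= theta i ^+ 2.
  move=> id; have le1 : theta d <= theta i by rewrite theta_le //; lia.
  by rewrite lerXn2r // ?nnegrE ?(le_trans _ le1) // ltW // theta_half_gt0.
case/thetaP => i iD ->; have [/main //|di] := leqP i d.
by rewrite -(sqrrN (theta i)) -(thetaN iD) main //; lia.
Qed.

Lemma theta1_ge i : (0 < i)%N -> (i < D)%N -> theta i ^+ 2 <= theta 1 ^+ 2.
Proof.
move=> i0 iD; rewrite -subr_ge0 subr_sqr mulr_ge0 //.
  by rewrite subr_ge0 theta_le // ltnW.
rewrite -[X in _ + X]opprK subr_ge0 -(thetaN (ltnW iD)).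
by rewrite theta_le //; lia.
Qed.

Lemma theta1_gt0 : 0 < theta 1.
Proof. by rewrite (lt_le_trans theta_half_gt0) // theta_le //; lia. Qed.

Lemma sqr_valency_ge t : eigenvalue A t -> t ^+ 2 <= k ^+ 2.
Proof.
case/thetaP => i iD ->; have [->|i0] := posnP i; first by rewrite theta0.
move: iD; rewrite leq_eqVlt => /orP[/eqP ->|iD]; last exact/ltW/sqr_theta_lt.
by rewrite -(subn0 D) thetaN // theta0 sqrrN.
Qed.

(** The second factor vanishes at [t = k] and [t = - k], the only eigenvalues where
    the first one is negative. *)
Lemma theta1_sign t : eigenvalue A t ->
  0 <= (theta 1 ^+ 2 - t ^+ 2) * (k ^+ 2 - t ^+ 2).
Proof.
move=> et; case/thetaP: (et) => i iD tE.
have [i0|i0] := posnP i; first by rewrite tE i0 theta0 subrr mulr0.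
move: iD; rewrite leq_eqVlt => /orP[/eqP iE|iD].
  by rewrite tE iE -(subn0 D) thetaN // theta0 sqrrN subrr mulr0.
by rewrite mulr_ge0 ?subr_ge0 ?sqr_valency_ge // tE theta1_ge.
Qed.

Lemma theta_half_sign t : eigenvalue A t ->
  0 <= - 1 * ((theta d ^+ 2 - t ^+ 2) * (k ^+ 2 - t ^+ 2)).
Proof.
move=> et; rewrite mulN1r -mulNr opprB.
by rewrite mulr_ge0 ?subr_ge0 ?sqr_valency_ge ?theta_half_le.
Qed.

End Extremal.

(** * Gaps of a cosine sequence *)

(** Replaces rewriting in a ring identity that holds modulo an equation. *)
Lemma eq_of_lincomb (C : pzRingType) (m l r x y : C) :
  l = r -> x - y = m * (l - r) -> x = y.
Proof. by move=> -> /eqP; rewrite subrr mulr0 subr_eq0 => /eqP. Qed.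

Section CosineDifferences.
Variables (C : numClosedFieldType) (X : finType) (e : rel X).
Hypothesis hG : bipartite_drg e.

Let hgraph : simple_connected_graph e. Proof. by case: hG. Qed.
Let hD : (4 <= diameter e)%N. Proof. by case: hG. Qed.

Local Notation dist := (dist e).
Local Notation D := (diameter e).
Local Notation b i := ((bnum e i)%:R : C).
Local Notation c i := ((cnum e i)%:R : C).
Local Notation k := ((valency e)%:R : C).
Local Notation A := (adjmx C e).
Local Notation radial := (@radial C X e).
Local Notation radial_step := (@radial_step C X e).
Local Notation radial_shift := (@radial_shift C X e).
Local Notation cosine := (@cosine C X e).

Lemma radial_shift2 a w h : radial_shift a (radial_shift (- a) w) h =
  radial_step (radial_step w) h - a ^+ 2 * w h.
Proof.
rewrite /radial_shift /radial_step; case: h => [|h] /=.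
  by rewrite (cnum0 hG); ring.
by ring.
Qed.

(** As [b h + c h = k], [A^2 - k^2] is a second order difference operator: it only
    sees the differences of coefficients two steps apart. *)
Lemma radial_step2 w h : (h <= D)%N ->
  radial_step (radial_step w) h = k ^+ 2 * w h
    - b h * b h.+1 * (w h - w h.+2) + c h * c h.-1 * (w h.-2 - w h).
Proof.
move=> hle; have bE := bnumE C hG hle; rewrite /radial_step.
have bE1 : b h * b h.+1 = b h * (k - c h.+1).
  move: hle; rewrite leq_eqVlt => /orP[/eqP ->|hlt].
    by rewrite (bnum_diam hG) !mul0r.
  by rewrite (bnumE C hG hlt).
apply: (eq_of_lincomb (m := w h) bE1).
case: h hle bE {bE1} => [|h] hle bE /=; rewrite bE.
  by rewrite (cnum0 hG); ring.
by rewrite (bnumE C hG (ltnW hle)); ring.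
Qed.

Lemma eq_radial_step w w' h : (h <= D)%N ->
  (forall j, (j <= D)%N -> w j = w' j) -> radial_step w h = radial_step w' h.
Proof.
move=> hle ww'; rewrite /radial_step ww' ?(leq_trans (leq_pred _)) //.
move: hle; rewrite leq_eqVlt => /orP[/eqP ->|hlt]; last by rewrite ww'.
by rewrite (bnum_diam hG) !mul0r.
Qed.

Section Eigen.
Variables (t eps : C).
Hypothesis et : eigenvalue A t.

Local Notation s := (cosine t).

Definition cosine_gap i := s i - s i.+2.
Local Notation tau := cosine_gap.

Lemma cosine_gap_real i : (tau i)^* = tau i.
Proof.
have tr : t^* = t by apply/CrealP/(eigenvalue_adj_real hG et).
by rewrite rmorphB /= !cosine_real.
Qed.

Lemma cosine_step2 h : (h <= D)%N -> radial_step (radial_step s) h = t ^+ 2 * s h.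
Proof.
move=> hle; rewrite (eq_radial_step (w' := fun j => t * s j) hle); last first.
  by move=> j jD; rewrite (cosine_stepE hG et jD).
have -> : radial_step (fun j => t * s j) h = t * radial_step s h.
  by rewrite /radial_step; ring.
by rewrite (cosine_stepE hG et hle) mulrA.
Qed.

(** The test function agrees with the cosine sequence up to a constant on the
    vertices at distance at most [i] of the parity of [i], and vanishes
    elsewhere. The quadratic form of [(A^2 - k^2)(A^2 - t^2)] then involves only
    the two consecutive gaps [tau i] and [tau i.+2]. *)
Lemma cosine_gap_sign i : (i.+4 <= D)%N -> eps != 0 ->
  (forall a, eigenvalue A a ->
    0 <= eps * ((t ^+ 2 - a ^+ 2) * (k ^+ 2 - a ^+ 2))) ->
  tau i != 0 -> 0 < eps * (tau i * tau i.+2).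
Proof.
move=> iD eps0 sgn tau0.
pose w j := if (j <= i)%N && (odd j == odd i) then s j - s i.+2 else 0.
have wE j : (j <= i.+2)%N -> odd j = odd i -> w j = s j - s i.+2.
  move=> ji jo; rewrite /w jo eqxx andbT; case: leqP => // ij.
  have -> : j = i.+2 by lia.
  by rewrite subrr.
have w0 j : (i < j)%N -> w j = 0 by move=> ij; rewrite /w leqNgt ij.
have wn j : odd j != odd i -> w j = 0 by rewrite /w => /negbTE ->; rewrite andbF.
(* [w1 = (A^2 - t^2) w] is constant up to [i] on the parity class of [i], so that
   [y = (A^2 - k^2) w1] vanishes there below [i]. *)
pose w1 := radial_shift t (radial_shift (- t) w).
pose y := radial_shift k (radial_shift (- k) w1).
have wi : w i = tau i by rewrite wE //; lia.
have cc j : (j < 2)%N -> c j * c j.-1 = 0.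
  by case: j => [|[|//]] _; rewrite /= (cnum0 hG) ?mul0r ?mulr0.
have w1E j : (j <= i)%N -> odd j = odd i -> w1 j = (t ^+ 2 - k ^+ 2) * s i.+2.
  move=> ji jo; have jD : (j <= D)%N by lia.
  have := cosine_step2 jD; rewrite /w1 radial_shift2 !radial_step2 //.
  rewrite (wE j.+2) ?(wE j) //=; try lia.
  have [j2|j2] := ltnP j 2.
    by rewrite cc // => E; apply: (eq_of_lincomb (m := 1) E); ring.
  rewrite (wE j.-2); try lia.
  by move=> E; apply: (eq_of_lincomb (m := 1) E); ring.
have w1E2 : w1 i.+2 = c i.+2 * c i.+1 * tau i.
  rewrite /w1 radial_shift2 radial_step2; last by lia.
  rewrite (w0 i.+2) // (w0 i.+4) //=; last by lia.
  by rewrite wi; ring.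
have w10 j : (i.+2 < j)%N -> (j <= D)%N -> w1 j = 0.
  move=> ij jD; rewrite /w1 radial_shift2 radial_step2 // !w0; try lia.
  by ring.
have yE j : (j <= D)%N ->
    y j = c j * c j.-1 * (w1 j.-2 - w1 j) - b j * b j.+1 * (w1 j - w1 j.+2).
  by move=> jD; rewrite /y radial_shift2 radial_step2 //; ring.
have y0 j : (j < i)%N -> odd j = odd i -> y j = 0.
  move=> ji jo; rewrite yE; last by lia.
  rewrite (w1E j) ?(w1E j.+2) //=; try lia.
  have [j2|j2] := ltnP j 2; first by rewrite cc //; ring.
  by rewrite (w1E j.-2); try lia; ring.
have yi : y i = b i * b i.+1 * (b i.+2 * b i.+3) * tau i.+2.
  have i2D : (i.+2 <= D)%N by lia.
  have := cosine_step2 i2D; rewrite radial_step2 //= => E.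
  rewrite yE; last by lia.
  have -> : c i * c i.-1 * (w1 i.-2 - w1 i) = 0.
    have [j2|j2] := ltnP i 2; first by rewrite cc //; ring.
    by rewrite !w1E ?subrr ?mulr0 //; lia.
  by rewrite w1E // w1E2 /cosine_gap;
    apply: (eq_of_lincomb (m := b i * b i.+1) E); ring.
have y4 : y i.+4 = c i.+4 * c i.+3 * (c i.+2 * c i.+1 * tau i).
  rewrite yE //= w1E2 [w1 i.+4]w10 //.
  have -> : b i.+4 * b i.+4.+1 * (0 - w1 i.+4.+2) = 0; last by ring.
  move: (iD); rewrite leq_eqVlt => /orP[/eqP ->|iD1].
    by rewrite (bnum_diam hG); ring.
  move: (iD1); rewrite leq_eqVlt => /orP[/eqP ->|iD2].
    by rewrite (bnum_diam hG); ring.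
  by rewrite w10 //; [ring | lia].
(* A vertex at distance [i.+4] from [x] detects that [y] is nonzero. *)
have [z4 [x z4x]] := dist_realized hgraph (diam_gt0 hG) iD.
have [z3 _ /(dist_step hgraph)[z2 _ /(dist_step hgraph)[z1 _]]] := dist_step hgraph z4x.
case/(dist_step hgraph) => z0 _ z0x.
pose u := radial w *m delta_mx (enum_rank x) 0 : 'cV_#|X|.
pose roots := [:: k; - k; t; - t].
have gu : shift_prod A roots *m u = radial y *m delta_mx (enum_rank x) 0.
  by rewrite mulmxA (shift_prod_radial hG).
have entry f z : (radial f *m delta_mx (enum_rank x) 0 : 'cV_#|X|) z 0 =
    f (dist (enum_val z) x).
  by rewrite -colE !mxE enum_rankK.
pose kappa : C := \sum_(z : X) (dist z x == i)%:R.
have qE : hdot u (shift_prod A roots *m u) = kappa * (tau i * y i).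
  rewrite gu /hdot.
  under eq_bigr do rewrite !entry.
  rewrite (sum_enum_val (fun z => (w (dist z x))^* * y (dist z x))) mulr_suml.
  apply: eq_bigr => z _; have [->|di] := eqVneq (dist z x) i.
    by rewrite mul1r wi cosine_gap_real.
  rewrite mul0r; have [ij|ji] := ltnP i (dist z x); first by rewrite w0 // conjC0 mul0r.
  have [po|po] := eqVneq (odd (dist z x)) (odd i); last by rewrite wn // conjC0 mul0r.
  by rewrite y0 ?mulr0 // ltn_neqAle di.
have kappa0 : 0 < kappa.
  by rewrite /kappa (bigD1 z0) //= z0x eqxx ltr_wpDr ?ltr01 ?sumr_ge0.
have [ge0 eq0] : 0 <= eps * hdot u (shift_prod A roots *m u) /\
    (hdot u (shift_prod A roots *m u) = 0 ->
     eps != 0 -> shift_prod A roots *m u = 0).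
  apply: shift_prod_psd; first exact: (adj_sym C hG).
    exact: adj_real.
  move=> a /sgn; rewrite /roots !big_cons big_nil; congr (0 <= _); ring.
have B0 : 0 < b i * b i.+1 * (b i.+2 * b i.+3).
  by rewrite !mulr_gt0 // ltr0n (bnum_gt0 hG) //; lia.
move: ge0; rewrite qE yi le_eqVlt => /orP[/eqP/esym/eqP|]; last first.
  have -> : eps * (kappa * (tau i * (b i * b i.+1 * (b i.+2 * b i.+3) * tau i.+2)))
    = kappa * (b i * b i.+1 * (b i.+2 * b i.+3)) * (eps * (tau i * tau i.+2)).
    by ring.
  by rewrite pmulr_rgt0 // mulr_gt0.
rewrite mulf_eq0 (negbTE eps0) /= => /eqP q0.
have : shift_prod A roots *m u = 0 by apply: eq0; rewrite // qE yi.
rewrite gu => y0'; have : y i.+4 = 0.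
  by rewrite -z4x -(enum_rankK z4) -entry y0' mxE.
move/eqP; rewrite y4 !mulf_eq0 (negbTE tau0) !(negbTE (cnum_neq0 C hG _)) //.
all: by lia.
Qed.

Lemma cosine_gap0 : tau 0 * (k * b 1) = k ^+ 2 - t ^+ 2.
Proof.
have k0 : k != 0 by rewrite (bnum_neq0 C hG) ?(diam_gt0 hG).
have := cosine_stepE hG et (diam_gt0 hG).
rewrite /radial_step (cnum1 hG) (bnumE C hG (diam_gt0 hG)) (cnum1 hG) /=.
rewrite /cosine_gap (_ : s 0 = 1) // (_ : s 1 = t / k) // => E.
apply: (eq_of_lincomb (m := - k) E).
by field.
Qed.

Lemma cosine_gap1 : t * tau 0 = b 2 * tau 1.
Proof.
have D2 : (2 <= D)%N by rewrite (leq_trans _ hD).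
have := cosine_stepE hG et (leq0n D); have := cosine_stepE hG et D2.
rewrite /radial_step /= (cnum0 hG) (bnumE C hG D2) (bnumE C hG (leq0n D)).
rewrite (cnum0 hG) /cosine_gap => E2 E0.
apply: (eq_of_lincomb (m := 1) E2); apply: (eq_of_lincomb (m := -1) E0).
by ring.
Qed.

Lemma cosine_gap2 : b 2 * b 3 * tau 2 = (t ^+ 2 - b 2) * tau 0.
Proof.
have D3 : (3 <= D)%N by rewrite (leq_trans _ hD).
have := cosine_stepE hG et D3; have := cosine_stepE hG et (diam_gt0 hG).
have E01 := cosine_gap1.
rewrite /radial_step /= (cnum1 hG) (bnumE C hG (diam_gt0 hG)) (cnum1 hG).
rewrite /cosine_gap in E01 * => E1 E3.
apply: (eq_of_lincomb (m := b 2) E1); apply: (eq_of_lincomb (m := - b 2) E3).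
apply: (eq_of_lincomb (m := - t) E01).
by rewrite (bnumE C hG D3); ring.
Qed.

(** From [tau 0] and [tau 1] on, no gap can be the first of its parity to vanish. *)
Lemma cosine_gap_neq0 : t != 0 -> t ^+ 2 != k ^+ 2 -> eps != 0 ->
  (forall a, eigenvalue A a ->
    0 <= eps * ((t ^+ 2 - a ^+ 2) * (k ^+ 2 - a ^+ 2))) ->
  forall i, (i.+2 <= D)%N -> tau i != 0.
Proof.
move=> t0 tk eps0 sgn i.
have tau0 : tau 0 != 0.
  apply: contraNneq tk => tau0; have := cosine_gap0.
  by rewrite tau0 mul0r => /esym/eqP; rewrite subr_eq0 eq_sym.
have tau1 : tau 1 != 0.
  apply: contraNneq tau0 => tau1; have := cosine_gap1; rewrite tau1 mulr0 => /eqP.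
  by rewrite mulf_eq0 (negbTE t0).
elim/ltn_ind: i => -[|[|i]] IH iD //.
have := cosine_gap_sign iD eps0 sgn (IH i (leqnSn _) (ltnW (ltnW iD))).
by apply: contraTneq => ->; rewrite !mulr0 ltxx.
Qed.

End Eigen.
End CosineDifferences.

(** * Cosine matrices *)

Section CosineMatrix.
Variables (C : numClosedFieldType) (X : finType) (e : rel X).
Hypothesis hG : bipartite_drg e.

Let hgraph : simple_connected_graph e. Proof. by case: hG. Qed.
Let hD : (4 <= diameter e)%N. Proof. by case: hG. Qed.

Local Notation dist := (dist e).
Local Notation D := (diameter e).
Local Notation b i := ((bnum e i)%:R : C).
Local Notation c i := ((cnum e i)%:R : C).
Local Notation k := ((valency e)%:R : C).
Local Notation A := (adjmx C e).
Local Notation radial := (@radial C X e).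
Local Notation cosine := (@cosine C X e).
Local Notation gap := (@cosine_gap C X e).
Local Notation theta := (theta C e).

(** [theta_tilde] as a function of the eigenvalue. *)
Definition tilde (t : C) : C := - 1 - b 2 * b 3 * (t ^+ 2 - b 2)^-1.

Lemma sqr_sub_bnum2_neq0 t : eigenvalue A t -> gap t 2 != 0 ->
  t ^+ 2 - b 2 != 0.
Proof.
move=> et g2; have b23 : b 2 * b 3 != 0.
  by rewrite mulf_neq0 ?(bnum_neq0 C hG) //; lia.
apply: contraTneq (mulf_neq0 b23 g2) => tb.
by rewrite (cosine_gap2 hG et) tb mul0r eqxx.
Qed.

(** The form in which [tilde t] occurs: the ratio of [s_4 - 1] to [s_2 - s_4]. *)
Lemma gap_tilde t : eigenvalue A t -> gap t 2 != 0 ->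
  gap t 2 * tilde t = - (gap t 0 + gap t 2).
Proof.
move=> et g2; have tb := sqr_sub_bnum2_neq0 et g2; rewrite /tilde.
apply: (eq_of_lincomb (m := - (t ^+ 2 - b 2)^-1) (cosine_gap2 hG et)).
by field.
Qed.

Lemma selfadj_radial w : (forall j, (w j)^* = w j) -> selfadj (radial w).
Proof.
move=> wr; apply: selfadj_real_sym; first exact: (tr_radial hG).
by move=> i j; rewrite !mxE wr.
Qed.

(** The cosine matrix is a positive multiple of the orthogonal projection onto
    the eigenspace. *)
Lemma cosine_matrix_sqr t : eigenvalue A t -> exists2 m : C, 0 < m &
  radial (cosine t) *m radial (cosine t) = m *: radial (cosine t).
Proof.
move=> et; set S := radial _.
have AS : A *m S = t *: S := adj_cosine hG et.
have dS j : exists2 q, distmx C e j *m S = q *: S &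
                       exists q', distmx C e j.+1 *m S = q' *: S.
  elim: j => [|j [q qE [q' qE']]].
    by exists 1; [rewrite scale1r distmxE (radial_one C hG) mul1mx | exists t].
  exists q' => //; have [jD|Dj] := ltnP j.+1 D; last first.
    by exists 0; rewrite distmx_big ?mul0mx ?scale0r.
  have c0 : c j.+2 != 0 by rewrite (cnum_neq0 C hG).
  exists ((c j.+2)^-1 * (t * q' - b j * q)); rewrite -scalerA scalerBl.
  have := congr1 (mulmx^~ S) (adj_distmx C hG j).
  rewrite -mulmxA qE' -scalemxAr AS mulmxDl -!scalemxAl qE !scalerA mulrC => ->.
  by rewrite addrC addKr scalerA mulVf ?scale1r.
have {dS} [m mE] : exists m, S *m S = m *: S.
  have qP j : exists q, distmx C e j *m S = q *: S by have [q] := dS j; exists q.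
  suff : exists m, (\sum_(j < D.+1) cosine t j *: distmx C e j) *m S = m *: S.
    by rewrite -(radial_sum e (cosine t)).
  elim/big_ind: _ => [|M N [m Mm] [n Nn]|j _].
  - by exists 0; rewrite mul0mx scale0r.
  - by exists (m + n); rewrite mulmxDl Mm Nn scalerDl.
  - by have [q qE] := qP j; exists (cosine t j * q); rewrite -scalemxAl qE scalerA.
exists m => //; have [x _] := vertex_exists hG.
have /matrixP/(_ (enum_rank x) (enum_rank x)) := mE.
rewrite !mxE (distxx hgraph) mulr1 => <-.
rewrite (bigD1 (enum_rank x)) //= !mxE (distxx hgraph) mulr1 ltr_wpDr //.
apply: sumr_ge0 => j _; rewrite !mxE (dist_sym hgraph (enum_val j)).
rewrite -{2}[cosine t _]cosine_real ?mul_conjC_ge0 //.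
by apply/CrealP/(eigenvalue_adj_real hG).
Qed.

Lemma cosine_matrix_psd t : eigenvalue A t -> forall v,
  0 <= hdot v (radial (cosine t) *m v) /\
  (hdot v (radial (cosine t) *m v) = 0 -> radial (cosine t) *m v = 0).
Proof.
move=> et v; have [m m0 mE] := cosine_matrix_sqr et.
have tr : t^* = t by apply/CrealP/(eigenvalue_adj_real hG).
have : m * hdot v (radial (cosine t) *m v) =
       hdot (radial (cosine t) *m v) (radial (cosine t) *m v).
  by rewrite -(selfadj_radial (cosine_real e tr)) mulmxA mE -scalemxAl hdotZr.
move=> E; split; first by rewrite -(pmulr_rge0 _ m0) E hdot_ge0.
by move=> h0; apply: hdot_eq0; rewrite -E h0 mulr0.
Qed.

Section Odd.
Hypothesis hodd : odd D.
Local Notation d := (D./2).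

Let D5 : (5 <= D)%N. Proof. by move: hodd hD; case: D => [|[|[|[|[|n]]]]]. Qed.

Lemma gap0_gt0 i : (0 < i)%N -> (i < D)%N -> 0 < gap (theta i) 0.
Proof.
move=> i0 iD.
have kb : 0 < k * b 1 by rewrite mulr_gt0 // ltr0n (bnum_gt0 hG) //; lia.
rewrite -(pmulr_lgt0 _ kb) cosine_gap0 // ?eigenvalue_theta 1?ltnW //.
by rewrite subr_gt0 sqr_theta_lt.
Qed.

Lemma theta1_gap i : (i.+2 <= D)%N -> gap (theta 1) i != 0.
Proof.
apply: (cosine_gap_neq0 hG (eps := 1)); rewrite ?oner_eq0 //.
- by rewrite (eigenvalue_theta C hG) //; lia.
- by rewrite gt_eqF // (theta1_gt0 C hG hodd).
- by rewrite lt_eqF // (sqr_theta_lt C hG) //; lia.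
- by move=> a /(theta1_sign hG hodd); rewrite mul1r; apply.
Qed.

Lemma theta_half_gap i : (i.+2 <= D)%N -> gap (theta d) i != 0.
Proof.
apply: (cosine_gap_neq0 hG (eps := - 1)); rewrite ?oppr_eq0 ?oner_eq0 //.
- by rewrite (eigenvalue_theta C hG) //; lia.
- by rewrite gt_eqF // (theta_half_gt0 C hG hodd).
- by rewrite lt_eqF // (sqr_theta_lt C hG) //; lia.
- by move=> a /(theta_half_sign hG hodd); apply.
Qed.

Lemma theta1_gap2 : 0 < gap (theta 1) 2.
Proof.
rewrite -(pmulr_rgt0 _ (gap0_gt0 (isT : 0 < 1)%N _)) //; last by lia.
rewrite -[X in 0 < X]mul1r; apply: (cosine_gap_sign hG); rewrite ?oner_eq0 //.
- by rewrite (eigenvalue_theta C hG) //; lia.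
- by move=> a /(theta1_sign hG hodd); rewrite mul1r; apply.
- by apply: theta1_gap; lia.
Qed.

Lemma theta_half_gap2 : gap (theta d) 2 < 0.
Proof.
have d0 : (0 < d)%N by lia.
have dD : (d < D)%N by lia.
rewrite -(pmulr_rlt0 _ (gap0_gt0 d0 dD)) -oppr_gt0 -mulN1r.
apply: (cosine_gap_sign hG); rewrite ?oppr_eq0 ?oner_eq0 //.
- by rewrite (eigenvalue_theta C hG) //; lia.
- by move=> a /(theta_half_sign hG hodd); apply.
- by apply: theta_half_gap; lia.
Qed.

End Odd.
End CosineMatrix.

(** * Levels with respect to a vertex *)

Section Levels.
Variables (C : numClosedFieldType) (X : finType) (e : rel X).
Hypothesis hG : bipartite_drg e.
Variable x : X.

Let hgraph : simple_connected_graph e. Proof. by case: hG. Qed.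
Let hbip : bipartite e. Proof. by case: hG. Qed.

Local Notation dist := (dist e).
Local Notation D := (diameter e).
Local Notation A := (adjmx C e).
Local Notation dmx := (distmx C e).
Local Notation radial := (@radial C X e).
Local Notation cosine := (@cosine C X e).
Local Notation tilde := (@tilde C X e).
Local Notation E := (dual_idem C e x).

Lemma dual_idem_diag i :
  E i = diag_mx (\row_y (dist x (enum_val y) == i)%:R).
Proof.
apply/matrixP => y z; rewrite !mxE mulrb.
by case: eqVneq => [->|]; case: eqP.
Qed.

Lemma dual_idem_mul m i (M : 'M_(_, m)) y z :
  (E i *m M) y z = (dist x (enum_val y) == i)%:R * M y z.
Proof. by rewrite dual_idem_diag mul_diag_mx !mxE. Qed.

Lemma mul_dual_idem m i (M : 'M_(m, _)) y z :
  (M *m E i) y z = M y z * (dist x (enum_val z) == i)%:R.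
Proof. by rewrite dual_idem_diag mul_mx_diag !mxE. Qed.

Lemma dual_idemM i j : E i *m E j = (i == j)%:R *: E i.
Proof.
apply/matrixP => y z; rewrite dual_idem_mul !mxE.
have [yi|_] := eqVneq (dist x (enum_val y)) i; last by rewrite andbF mulr0 mul0r.
by rewrite yi andbT mul1r -natrM mulnb andbC.
Qed.

Lemma dual_idem_id i : E i *m E i = E i.
Proof. by rewrite dual_idemM eqxx scale1r. Qed.

Lemma dual_idem_big i : (D < i)%N -> E i = 0.
Proof.
move=> Di; apply/matrixP => y z; rewrite !mxE.
by rewrite ltn_eqF ?andbF // (leq_ltn_trans _ Di) ?dist_le_diam.
Qed.

Lemma sum_dual_idem : \sum_(i < D.+1) E i = 1%:M.
Proof.
apply/matrixP => y z; rewrite summxE !mxE.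
have dD : (dist x (enum_val y) < D.+1)%N by rewrite ltnS dist_le_diam.
rewrite (bigD1 (Ordinal dD)) //= !mxE eqxx andbT big1 ?addr0 // => i.
by rewrite -val_eqE /= !mxE eq_sym => /negbTE ->; rewrite andbF.
Qed.

Lemma dual_idem_selfadj i : selfadj (E i).
Proof.
apply: selfadj_real_sym => [|y z]; last by rewrite !mxE conjC_nat.
by rewrite dual_idem_diag tr_diag_mx.
Qed.

(** Two vertices at distances [i] and [h] from [x] are at a distance [j] obeying
    the triangle inequality and, the graph being bipartite, a parity rule. *)
Definition admissible i h j :=
  [&& (i <= j + h)%N, (h <= i + j)%N, (j <= i + h)%N & ~~ odd (i + j + h)].

Lemma admissible_dist y z : admissible (dist x y) (dist x z) (dist y z).
Proof.
apply/and4P; split.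
- by rewrite addnC (dist_sym hgraph y) dist_triangle.
- by rewrite dist_triangle.
- by rewrite (dist_sym hgraph x y) dist_triangle.
- have := odd_dist_add hgraph hbip x y z.
  by rewrite !oddD => ->; case: (odd _); case: (odd _).
Qed.

(** Between two levels a radial matrix depends on few of its coefficients. *)
Lemma level_radial m i h (v : 'M[C]_(#|X|, m)) w w' : E h *m v = v ->
  (forall j, (j <= D)%N -> admissible i h j -> w j = w' j) ->
  E i *m (radial w *m v) = E i *m (radial w' *m v).
Proof.
move=> <- ww'; rewrite !mulmxA; congr (_ *m _).
apply/matrixP => y z; rewrite !mul_dual_idem !dual_idem_mul !mxE.
have [yi|] := eqVneq (dist x (enum_val y)) i; last by rewrite !mul0r.
have [zh|] := eqVneq (dist x (enum_val z)) h; last by rewrite !mulr0.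
by rewrite ww' ?dist_le_diam // -yi -zh admissible_dist.
Qed.

Lemma level_dist0 m i h j (v : 'M[C]_(#|X|, m)) : E h *m v = v -> ~~ admissible i h j ->
  E i *m (dmx j *m v) = 0.
Proof.
move=> hv nij; rewrite distmxE (level_radial (w' := fun=> 0) hv).
  by rewrite (_ : radial (fun=> 0) = 0) ?mul0mx ?mulmx0 //; apply/matrixP=> y z; rewrite !mxE.
by move=> j' _ adm; case: eqP adm nij => // -> ->.
Qed.

Lemma level_adj m i (v : 'M[C]_(#|X|, m)) : E i.+1 *m (A *m v) =
  E i.+1 *m (A *m (E i *m v)) + E i.+1 *m (A *m (E i.+2 *m v)).
Proof.
rewrite -!mulmxDr -mulmxDl !mulmxA; congr (_ *m _).
apply/matrixP => y z; rewrite mulmxDr [RHS]mxE !mul_dual_idem !dual_idem_mul -mulrDr mxE.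
have [yi|] := eqVneq (dist x (enum_val y)) i.+1; last by rewrite !mul0r.
have [yz|] := eqVneq (dist (enum_val y) (enum_val z)) 1%N; last by rewrite !(mulr0, mul0r).
have := dist_adj hgraph hbip x yz.
rewrite (dist_sym hgraph (enum_val y)) (dist_sym hgraph (enum_val z)) yi.
move: (dist x (enum_val z)) => n [[<-]|->].
  by rewrite eqxx (@ltn_eqF i i.+2) ?leqnSn //= addr0 !mulr1.
by rewrite eqxx (@gtn_eqF i i.+2) ?leqnSn //= add0r !mulr1.
Qed.

Lemma level0_adj m (v : 'M[C]_(#|X|, m)) : E 0 *m (A *m v) = E 0 *m (A *m (E 1 *m v)).
Proof.
rewrite !mulmxA; congr (_ *m _).
apply/matrixP => y z; rewrite !mul_dual_idem !dual_idem_mul mxE.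
have [yi|] := eqVneq (dist x (enum_val y)) 0%N; last by rewrite !mul0r.
have [yz|] := eqVneq (dist (enum_val y) (enum_val z)) 1%N; last by rewrite !(mulr0, mul0r).
have := dist_adj hgraph hbip x yz.
rewrite (dist_sym hgraph (enum_val y)) (dist_sym hgraph (enum_val z)) yi.
by case=> // ->; rewrite /= !mulr1.
Qed.

End Levels.

(** * The local space and the bounds on its eigenvalues *)

Lemma admissible2 i j : admissible i.+2 2 j -> [\/ j = i, j = i.+2 | j = i.+4].
Proof.
case/and4P => ij _ ji; rewrite !addn2 /= !negbK => par.
have [m jE] : exists m, j = (i + m)%N by exists (j - i)%N; lia.
case: m jE => [|[|[|[|[|m]]]]] jE; try (exfalso; lia).
- by constructor 1; lia.
- by constructor 2; lia.
- by constructor 3; lia.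
Qed.

Section LocalSpace.
Variables (C : numClosedFieldType) (X : finType) (e : rel X).
Hypothesis hG : bipartite_drg e.
Variable x : X.

Let hgraph : simple_connected_graph e. Proof. by case: hG. Qed.
Let hD : (4 <= diameter e)%N. Proof. by case: hG. Qed.

Local Notation dist := (dist e).
Local Notation D := (diameter e).
Local Notation A := (adjmx C e).
Local Notation dmx := (distmx C e).
Local Notation radial := (@radial C X e).
Local Notation cosine := (@cosine C X e).
Local Notation gap := (@cosine_gap C X e).
Local Notation tilde := (@tilde C X e).
Local Notation E := (dual_idem C e x).
Local Notation V := 'cV[C]_#|X|.
Local Notation theta := (theta C e).

(** The part of level two that is orthogonal to the modules of endpoint zero and
    one. *)
Definition local_space (v : V) := E 2 *m v = v /\ E 1 *m (A *m v) = 0.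

Definition local_adj : 'M[C]_#|X| := E 2 *m dmx 2 *m E 2.
Local Notation B := local_adj.

Lemma dual_idem_eq0 h i (v : V) : E h *m v = v -> i != h -> E i *m v = 0.
Proof.
by move=> <- ih; rewrite mulmxA dual_idemM (negbTE ih) scale0r mul0mx.
Qed.

Lemma distmx0_mul (v : V) : dmx 0 *m v = v.
Proof. by rewrite distmxE (radial_one C hG) mul1mx. Qed.

(** [c_2 E 0 A_2 v] is the level zero part of [A^2 v], and [A v] has no component
    on level one. *)
Lemma local_far0 v : local_space v -> E 0 *m (dmx 2 *m v) = 0.
Proof.
case=> v2 v1; have := congr1 (fun M => E 0 *m (M *m v)) (adj_distmx C hG 0).
rewrite -/A -mulmxA (level0_adj hG) v1 !mulmx0 mulmxDl -!scalemxAl distmx0_mul.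
rewrite mulmxDr -!scalemxAr (dual_idem_eq0 v2) // scaler0 add0r => /esym/eqP.
by rewrite scaler_eq0 (negbTE (cnum_neq0 C hG _)) ?(leq_trans _ hD) // => /eqP.
Qed.

Lemma local_sum0 v : local_space v -> radial (fun=> 1) *m v = 0.
Proof.
move=> vU; have [v2 v1] := vU; have := local_far0 vU.
rewrite distmxE (level_radial hG (w' := fun=> 1) v2) => [/colP v0|j _]; last first.
  by case/and4P=> _ j2 j2' _; rewrite (_ : j = 2%N) ?eqxx //; lia.
apply/colP => y; rewrite mxE; have := v0 (enum_rank x).
rewrite dual_idem_mul enum_rankK (distxx hgraph) mul1r !mxE => s0; rewrite -[RHS]s0.
by apply: eq_bigr => z _; rewrite !mxE.
Qed.

(** The vertices of level two are at distance [i], [i.+2] or [i.+4] from those of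
    level [i.+2]. *)
Lemma level_three v w i : local_space v -> E i.+2 *m (radial w *m v) =
  w i *: (E i.+2 *m (dmx i *m v)) + w i.+2 *: (E i.+2 *m (dmx i.+2 *m v))
  + w i.+4 *: (E i.+2 *m (dmx i.+4 *m v)).
Proof.
case=> v2 _; rewrite (level_radial hG (w' := fun j => w i * (j == i)%:R +
  w i.+2 * (j == i.+2)%:R + w i.+4 * (j == i.+4)%:R) v2).
  rewrite -[radial _]radialD -[radial (fun _ => _ + _)]radialD -!radialZ.
  by rewrite -!distmxE !mulmxDl !mulmxDr -!scalemxAl -!scalemxAr.
have n2 m : (m == m.+2) = false by elim: m.
have n4 m : (m == m.+4) = false by elim: m.
by move=> j _ /admissible2[] ->; rewrite eqxx 2?n2 ?n4 2?[_.+2 == _]eq_sym 2?[_.+4 == _]eq_sym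
  2?n2 ?n4 !(mulr1, mulr0, addr0, add0r).
Qed.

Lemma level_three_sum0 v i : local_space v ->
  E i.+2 *m (dmx i.+4 *m v) =
  - (E i.+2 *m (dmx i *m v)) - E i.+2 *m (dmx i.+2 *m v).
Proof.
move=> vU; have := level_three (fun=> 1) i vU.
rewrite local_sum0 // mulmx0 !scale1r => /esym/eqP.
by rewrite addrC addr_eq0 opprD => /eqP.
Qed.

Lemma level_low v i j : local_space v -> (i < 2)%N -> E i *m (dmx j *m v) = 0.
Proof.
move=> vU; have [v2 v1] := vU; case: i => [|[|//]] _.
  have [->|j2] := eqVneq j 2%N; first exact: local_far0.
  by rewrite (level_dist0 hG v2) // /admissible; lia.
have [->//|j1] := eqVneq j 1%N.
have [->|j3] := eqVneq j 3%N; last first.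
  by rewrite (level_dist0 hG v2) // /admissible; lia.
have := congr1 (mulmx (E 1)) (local_sum0 vU).
rewrite (level_radial hG (w' := fun j => (j == 1)%:R + (j == 3)%:R) v2).
  by rewrite -radialD -!distmxE mulmxDl mulmxDr v1 add0r mulmx0.
by case=> [|[|[|[|j']]]] _ /and4P[] //= _ _ _ _; rewrite ?addr0 ?add0r.
Qed.

Lemma local_adjE v : local_space v -> B *m v = E 2 *m (dmx 2 *m v).
Proof. by case=> v2 _; rewrite /local_adj -!mulmxA v2. Qed.

(** [E 1 A B v] is the level one part of [A A_2 v = b_1 A v + c_3 A_3 v]. *)
Lemma local_space_adj v : local_space v -> local_space (B *m v).
Proof.
move=> vU; have [v2 v1] := vU; rewrite local_adjE //; split.
  by rewrite mulmxA dual_idem_id.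
have := level_adj hG x 0 (dmx 2 *m v).
rewrite (local_far0 vU) !mulmx0 add0r => <-.
rewrite [A *m (_ *m _)]mulmxA (adj_distmx C hG 1) mulmxDl mulmxDr -!scalemxAl -!scalemxAr.
by rewrite !level_low // !scaler0 addr0.
Qed.

Lemma local_space_lin a u v :
  local_space u -> local_space v -> local_space (a *: u + v).
Proof.
move=> [u2 u1] [v2 v1]; rewrite /local_space !mulmxDr -!scalemxAr u2 v2 u1 v1.
by rewrite scaler0 addr0.
Qed.

Lemma local_space_shift a v : local_space v -> local_space ((B - a%:M) *m v).
Proof.
move=> vU; rewrite mulmxBl mul_scalar_mx addrC -scaleNr.
by apply: local_space_lin => //; apply: local_space_adj.
Qed.

Lemma local_adj_selfadj : selfadj B.
Proof.
move=> u v; have dself : selfadj (dmx 2).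
  by rewrite distmxE; apply: (selfadj_radial hG) => j; rewrite conjC_nat.
by rewrite /local_adj -!mulmxA dual_idem_selfadj dself dual_idem_selfadj.
Qed.

Lemma local_shift_selfadj a : a^* = a -> selfadj (B - a%:M).
Proof.
move=> ar u v; rewrite !mulmxBl !mul_scalar_mx -scaleNr hdotDr hdotZr.
by rewrite local_adj_selfadj -scaleNr hdotDl hdotZl rmorphN /= ar.
Qed.

(** By [J v = 0] the three components of [S v] on level two reduce to [v] and
    [B v]. *)
Lemma level2_cosine t v : eigenvalue A t -> gap t 2 != 0 -> local_space v ->
  E 2 *m (radial (cosine t) *m v) = gap t 2 *: ((B - (tilde t)%:M) *m v).
Proof.
move=> et g2 vU; have [v2 _] := vU.
rewrite level_three // level_three_sum0 // distmx0_mul v2 mulmxBl mul_scalar_mx.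
rewrite local_adjE // [RHS]scalerBr scalerA gap_tilde // /cosine_gap.
set u := E 2 *m _; rewrite !scalerDr !scalerN scaleNr opprK !scalerDl !scaleNr.
by apply/colP => y; rewrite !mxE; ring.
Qed.

(** The cosine matrix of [t] is positive semidefinite, and on [local_space] its
    quadratic form is that of [B - tilde t] times a gap: hence the bound that
    [tilde t] sets to the local eigenvalues, and what happens when it is met. *)
Lemma local_bound t v : eigenvalue A t -> gap t 2 != 0 -> local_space v ->
  0 <= gap t 2 * hdot v ((B - (tilde t)%:M) *m v) /\
  (hdot v ((B - (tilde t)%:M) *m v) = 0 -> radial (cosine t) *m v = 0).
Proof.
move=> et g2 vU; have [v2 _] := vU.
have -> : gap t 2 * hdot v ((B - (tilde t)%:M) *m v) =
          hdot v (radial (cosine t) *m v).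
  by rewrite -hdotZr -level2_cosine // dual_idem_selfadj v2.
have [ge0 eq0] := cosine_matrix_psd hG et v; split=> // h0; apply: eq0.
by rewrite -{1}v2 -dual_idem_selfadj level2_cosine // hdotZr h0 mulr0.
Qed.

Lemma local_tight t v : eigenvalue A t -> gap t 2 != 0 -> local_space v ->
  radial (cosine t) *m v = 0 <-> B *m v = tilde t *: v.
Proof.
move=> et g2 vU; split=> [Sv0|Bv].
  have := level2_cosine et g2 vU; rewrite Sv0 mulmx0 => /esym/eqP.
  by rewrite scaler_eq0 (negbTE g2) /= mulmxBl mul_scalar_mx subr_eq0 => /eqP.
have [_] := local_bound et g2 vU; apply.
by rewrite mulmxBl mul_scalar_mx Bv subrr hdot0r.
Qed.

Lemma tilde_real t : eigenvalue A t -> (tilde t)^* = tilde t.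
Proof.
move=> /(eigenvalue_adj_real hG)/CrealP tr.
rewrite /tilde rmorphB /= rmorphN /= conjC1 rmorphM /= rmorphM /= fmorphV /=.
by rewrite rmorphB /= rmorphXn /= tr !conjC_nat.
Qed.

Lemma local_shift_comm al be :
  (B - al%:M) *m (B - be%:M) = (B - be%:M) *m (B - al%:M).
Proof.
rewrite !mulmxBl !mulmxBr !mul_scalar_mx !mul_mx_scalar !scale_scalar_mx.
by rewrite mulrC opprB opprB addrACA [- _ + _]addrC addrACA.
Qed.

Section Odd.
Hypothesis hodd : odd D.
Local Notation d := (D./2).
Local Notation alpha := (tilde (theta 1)).
Local Notation beta := (tilde (theta d)).

Let e1 : eigenvalue A (theta 1).
Proof. by rewrite (eigenvalue_theta C hG) // (diam_gt0 hG). Qed.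
Let ed : eigenvalue A (theta d).
Proof. by rewrite (eigenvalue_theta C hG) //; lia. Qed.
Let g1 : gap (theta 1) 2 != 0.
Proof. by rewrite gt_eqF // theta1_gap2. Qed.
Let gd : gap (theta d) 2 != 0.
Proof. by rewrite lt_eqF // theta_half_gap2. Qed.

Lemma tilde_lt : alpha < beta.
Proof.
have h1 : alpha < -1.
  rewrite -subr_lt0 -(pmulr_rlt0 _ (theta1_gap2 C hG hodd)) mulrBr gap_tilde //.
  by rewrite mulrN1 opprD opprK addrNK oppr_lt0 gap0_gt0 //; lia.
apply: lt_trans h1 _.
rewrite -subr_gt0 -(nmulr_rlt0 _ (theta_half_gap2 C hG hodd)) mulrBr gap_tilde //.
by rewrite mulrN1 opprD opprK addrNK oppr_lt0 gap0_gt0 //; lia.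
Qed.

(** With [p = (B - alpha) v] and [q = (B - beta) v], so that
    [p - q = (beta - alpha) v], symmetry of [B] gives
    [(beta - alpha) <p, q> = <p, (B - beta) p> - <q, (B - alpha) q>],
    a sum of two nonpositive terms. *)
Lemma local_product_le0 v : local_space v ->
  let Q := (B - alpha%:M) *m (B - beta%:M) in
  hdot v (Q *m v) <= 0 /\ (hdot v (Q *m v) = 0 -> Q *m v = 0).
Proof.
move=> vU Q; set p := (B - alpha%:M) *m v; set q := (B - beta%:M) *m v.
have sa := local_shift_selfadj (tilde_real e1).
have sb := local_shift_selfadj (tilde_real ed).
have comm := local_shift_comm alpha beta.
have pU : local_space p by apply: local_space_shift.
have qU : local_space q by apply: local_space_shift.
have pq : p - q = (beta - alpha) *: v.
  rewrite /p /q !mulmxBl !mul_scalar_mx opprB [RHS]scalerBl.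
  by rewrite [LHS]addrC addrA subrK.
have vQ : hdot v (Q *m v) = hdot p q by rewrite /Q -mulmxA sa.
have [pb pb0] := local_bound ed gd pU.
have [qa qa0] := local_bound e1 g1 qU.
have pb' : hdot p ((B - beta%:M) *m p) <= 0.
  by rewrite -(nmulr_rge0 _ (theta_half_gap2 C hG hodd)).
have qa' : 0 <= hdot q ((B - alpha%:M) *m q).
  by rewrite -(pmulr_rge0 _ (theta1_gap2 C hG hodd)).
have ba : 0 < beta - alpha by rewrite subr_gt0 tilde_lt.
have key : (beta - alpha) * hdot p q =
    hdot p ((B - beta%:M) *m p) - hdot q ((B - alpha%:M) *m q).
  rewrite -hdotZr [X in hdot p X](_ : _ = (B - beta%:M) *m (p - q)); last first.
    by rewrite pq -scalemxAr.
  rewrite mulmxBr hdotBr; congr (_ - _).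
  by rewrite -sa mulmxA comm -mulmxA sb.
rewrite vQ; split.
  rewrite -(pmulr_rle0 _ ba) key -[0]subr0 lerB //.
move=> h0; have : hdot p ((B - beta%:M) *m p) = 0.
  apply: le_anti; rewrite pb' /=; move: key; rewrite h0 mulr0 => /esym/eqP.
  by rewrite subr_eq0 => /eqP ->.
move=> /pb0 /(local_tight ed gd pU) Bp.
by rewrite /Q comm -mulmxA -/p mulmxBl mul_scalar_mx Bp subrr.
Qed.

End Odd.
End LocalSpace.

(** * The local adjacency matrix on the image of level one *)

Section Projection.
Variables (C : numClosedFieldType) (X : finType) (e : rel X).
Hypothesis hG : bipartite_drg e.
Variable x : X.

Let hgraph : simple_connected_graph e. Proof. by case: hG. Qed.
Let hD : (4 <= diameter e)%N. Proof. by case: hG. Qed.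

Local Notation dist := (dist e).
Local Notation D := (diameter e).
Local Notation b i := ((bnum e i)%:R : C).
Local Notation c i := ((cnum e i)%:R : C).
Local Notation k := ((valency e)%:R : C).
Local Notation p22 := ((pnum e 2 2 2)%:R : C).
Local Notation A := (adjmx C e).
Local Notation dmx := (distmx C e).
Local Notation radial := (@radial C X e).
Local Notation E := (dual_idem C e x).
Local Notation B := (local_adj C e x).
Local Notation J := (radial (fun=> 1)).

(** The vertices of level [i] adjacent to a given vertex are counted by the
    intersection numbers. *)
Lemma adj_level_J i y z : (A *m (E i *m J)) y z =
  c (dist (enum_val y) x) * ((dist (enum_val y) x).-1 == i)%:R +
  b (dist (enum_val y) x) * ((dist (enum_val y) x).+1 == i)%:R.
Proof.
rewrite -(sum_neighbours hG (fun h => (h == i)%:R)) mxE.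
rewrite -(sum_enum_valP (fun t => dist (enum_val y) t == 1%N)
  (fun t => (dist t x == i)%:R)) [RHS]big_mkcond /=.
apply: eq_bigr => t _; rewrite dual_idem_mul !mxE mulr1 (dist_sym hgraph x).
by case: (_ == 1%N); rewrite ?mul1r ?mul0r.
Qed.

Lemma level_up_J i : E i.+1 *m (A *m (E i *m J)) = c i.+1 *: (E i.+1 *m J).
Proof.
apply/matrixP => y z; rewrite dual_idem_mul [RHS]mxE dual_idem_mul adj_level_J !mxE.
rewrite (dist_sym hgraph (enum_val y)).
have [->|] := eqVneq (dist x (enum_val y)) i.+1; last by rewrite !mul0r mulr0.
by rewrite /= eqxx (@gtn_eqF i i.+2) // mulr0 addr0 !mul1r.
Qed.

Lemma level_down_J i : E i *m (A *m (E i.+1 *m J)) = b i *: (E i *m J).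
Proof.
apply/matrixP => y z; rewrite dual_idem_mul [RHS]mxE dual_idem_mul adj_level_J !mxE.
rewrite (dist_sym hgraph (enum_val y)).
have [->|] := eqVneq (dist x (enum_val y)) i; last by rewrite !mul0r mulr0.
by rewrite eqxx (_ : i.-1 == i.+1 = false) ?mulr0 ?add0r ?mul1r //; lia.
Qed.

Lemma tr_dual_idem i : (E i)^T = E i.
Proof. by rewrite dual_idem_diag tr_diag_mx. Qed.

Lemma tr_J : J^T = J. Proof. exact: (tr_radial hG). Qed.

Lemma J_level_up i : J *m E i *m A *m E i.+1 = c i.+1 *: (J *m E i.+1).
Proof.
apply: trmx_inj; rewrite linearZ /= !trmx_mul tr_J (adj_sym C hG) !tr_dual_idem.
exact: level_up_J.
Qed.

Lemma J_level_down i : J *m E i.+1 *m A *m E i = b i *: (J *m E i).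
Proof.
apply: trmx_inj; rewrite linearZ /= !trmx_mul tr_J (adj_sym C hG) !tr_dual_idem.
exact: level_down_J.
Qed.

Definition sphere_size i : C := \sum_z (dist x z == i)%:R.

Lemma J_dual_J i : J *m E i *m J = sphere_size i *: J.
Proof.
apply/matrixP => y z; rewrite mxE !mxE mulr1.
rewrite /sphere_size -(sum_enum_val (fun t => (dist x t == i)%:R)).
by apply: eq_bigr => t _; rewrite mul_dual_idem !mxE mulr1 mul1r.
Qed.

Lemma trace_dual_idem i : \tr (E i) = sphere_size i.
Proof.
rewrite /sphere_size -(sum_enum_val (fun t => (dist x t == i)%:R)).
by apply: eq_bigr => t _; rewrite !mxE eqxx.
Qed.

Lemma trace_dual_J i : \tr (E i *m J) = sphere_size i.
Proof.
rewrite /sphere_size -(sum_enum_val (fun t => (dist x t == i)%:R)).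
by apply: eq_bigr => t _; rewrite dual_idem_mul mxE mulr1.
Qed.

Lemma sphere_size1 : sphere_size 1 = k.
Proof.
rewrite -(degreeE C hG x) big_mkcond; apply: eq_bigr => z _.
by case: eqP.
Qed.

Lemma J_neq0 : J != 0.
Proof.
apply/eqP => /matrixP/(_ (enum_rank x) (enum_rank x))/eqP.
by rewrite !mxE oner_eq0.
Qed.

(** Double counting of the edges between levels one and two. *)
Lemma sphere_size2 : c 2 * sphere_size 2 = k * b 1.
Proof.
have E1 : c 2 *: (J *m E 2 *m J) = b 1 *: (J *m E 1 *m J).
  rewrite -mulmxA scalemxAr -level_up_J !mulmxA.
  by rewrite scalemxAl -J_level_down.
move: E1; rewrite !J_dual_J !scalerA => /eqP; rewrite -subr_eq0 -scalerBl.
rewrite scaler_eq0 (negbTE J_neq0) orbF subr_eq0 sphere_size1 => /eqP ->.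
exact: mulrC.
Qed.

Lemma level_one_distmx2 : E 1 *m dmx 2 *m E 1 = E 1 *m J *m E 1 - E 1.
Proof.
have := level_radial hG (i := 1%N) (w := fun=> 1)
  (w' := fun j => (j == 0)%:R + (j == 2)%:R) (dual_idem_id C e x 1).
rewrite -radialD mulmxDl mulmxDr -!distmxE => E1.
rewrite -!mulmxA E1; last first.
  by case=> [|[|[|j]]] _ /and4P[] //= _ _ _ _; rewrite ?addr0 ?add0r.
by rewrite (distmx0 C hG) mul1mx dual_idem_id addrAC subrr add0r.
Qed.

(** Level zero is the single vertex [x]. *)
Lemma dual0_sandwich i j : E i *m dmx i *m E 0 *m dmx j *m E j = E i *m J *m E j.
Proof.
apply/matrixP => y z; rewrite !mul_dual_idem mxE.
rewrite (bigD1 (enum_rank x)) //= big1 ?addr0 => [|t tx]; last first.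
  rewrite mul_dual_idem; have [xt|] := eqVneq (dist x (enum_val t)) 0%N.
    by move/eqP/(dist0P hgraph): xt tx => ->; rewrite enum_valK eqxx.
  by rewrite mulr0 mul0r.
rewrite mul_dual_idem !dual_idem_mul !mxE enum_rankK (distxx hgraph).
rewrite (dist_sym hgraph (enum_val y)).
by case: (_ == i); case: (_ == j); rewrite !(mulr1, mul1r, mulr0, mul0r).
Qed.

(** Two distinct neighbours of [x] have [c 2] common neighbours, one of which is [x]. *)
Lemma down_up : E 1 *m A *m E 2 *m A *m E 1 =
  b 2 *: E 1 + (c 2 - 1) *: (E 1 *m J *m E 1).
Proof.
have := level_adj hG x 0 (A *m E 1).
rewrite !mulmxA (dual0_sandwich 1 1) => E1.
have -> : E 1 *m A *m E 2 *m A *m E 1 = E 1 *m A *m A *m E 1 - E 1 *m J *m E 1.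
  by rewrite E1 addrC addKr.
rewrite -[E 1 *m A *m A]mulmxA (adj_distmx C hG 0) mulmxDr mulmxDl.
rewrite -!scalemxAr -!scalemxAl level_one_distmx2.
rewrite (distmx0 C hG) mulmx1 dual_idem_id.
rewrite (bnumE C hG (leq0n D)) (bnumE C hG (_ : 2 <= D)%N) ?(leq_trans _ hD) // (cnum0 hG).
set M := E 1 *m J *m E 1; set N := E 1.
by apply/matrixP => y z; rewrite !mxE; ring.
Qed.

Lemma adj_level_one : A *m E 1 = E 0 *m A *m E 1 + E 2 *m A *m E 1.
Proof.
have := level_adj hG x 0 (1%:M : 'M[C]_#|X|); rewrite !mulmx1 => /(congr1 trmx).
by rewrite linearD /= !trmx_mul (adj_sym C hG) !tr_dual_idem.
Qed.

Lemma distmx2_adj : dmx 2 *m A = b 1 *: A + c 3 *: dmx 3.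
Proof.
apply: trmx_inj; rewrite trmx_mul (adj_sym C hG) (tr_distmx C hG).
by rewrite (adj_distmx C hG) linearD /= !linearZ /= !(tr_distmx C hG).
Qed.

Lemma level_two_distmx3 : E 2 *m dmx 3 *m E 1 = E 2 *m J *m E 1 - E 2 *m A *m E 1.
Proof.
have := level_radial hG (i := 2%N) (w := fun=> 1)
  (w' := fun j => (j == 1)%:R + (j == 3)%:R) (dual_idem_id C e x 1).
rewrite -radialD mulmxDl mulmxDr -!distmxE => E1.
rewrite -!mulmxA E1; first by rewrite addrAC subrr add0r.
by case=> [|[|[|[|j]]]] _ /and4P[] //= _ _ _ _; rewrite ?addr0 ?add0r.
Qed.

(** Compare the level two parts of [A_2 A] and of [b_1 A + c_3 A_3] on level one,
    the walks through [x] being removed. *)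
Lemma local_adj_up : B *m (E 2 *m A *m E 1) =
  (b 3 - 1) *: (E 2 *m A *m E 1) + (c 3 - 1) *: (E 2 *m J *m E 1).
Proof.
have E1 : E 2 *m dmx 2 *m (A *m E 1) =
    b 1 *: (E 2 *m A *m E 1) + c 3 *: (E 2 *m dmx 3 *m E 1).
  rewrite -mulmxA [dmx 2 *m _]mulmxA distmx2_adj mulmxDl mulmxDr.
  by rewrite -!scalemxAl -!scalemxAr !mulmxA.
have -> : B *m (E 2 *m A *m E 1) =
    E 2 *m dmx 2 *m (A *m E 1) - E 2 *m J *m E 1.
  rewrite adj_level_one mulmxDr !mulmxA (dual0_sandwich 2 1) addrAC subrr add0r.
  by rewrite /local_adj -!mulmxA [E 2 *m (E 2 *m _)]mulmxA dual_idem_id.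
rewrite E1 level_two_distmx3.
have D3 : (3 <= D)%N by rewrite ltnW.
rewrite (bnumE C hG D3) (bnumE C hG (diam_gt0 hG)) (cnum1 hG).
by apply/matrixP => y z; rewrite !mxE; ring.
Qed.

Lemma local_adj_J : B *m (E 2 *m J) = p22 *: (E 2 *m J).
Proof.
apply/matrixP => y z; rewrite /local_adj -!mulmxA [E 2 *m (E 2 *m J)]mulmxA dual_idem_id.
rewrite dual_idem_mul [RHS]mxE dual_idem_mul.
have [xy|] := eqVneq (dist x (enum_val y)) 2%N; last by rewrite !mul0r mulr0.
rewrite (pnumE hG _ _ xy) (card_dist_sum C) !mul1r [radial _ _ _]mxE mulr1 mxE.
rewrite -(sum_enum_valP (fun t => dist x t == 2%N)
  (fun t => (dist t (enum_val y) == 2%N)%:R)) [RHS]big_mkcond /=.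
apply: eq_bigr => t _; rewrite dual_idem_mul !mxE mulr1 (dist_sym hgraph (enum_val y)).
by case: (dist x _ == _); rewrite ?mulr1 ?mulr0.
Qed.

Lemma dual2_J_neq0 : E 2 *m J != 0.
Proof.
have c2 : c 2 != 0 by rewrite (cnum_neq0 C hG) //= (leq_trans _ hD).
have E2 : c 2 *: (J *m (E 2 *m J)) = (k * b 1) *: J.
  by rewrite mulmxA J_dual_J scalerA sphere_size2.
apply/eqP => E2J; move: E2; rewrite E2J mulmx0 scaler0 => /esym/eqP.
rewrite scaler_eq0 (negbTE J_neq0) orbF mulf_eq0.
by rewrite !(negbTE (bnum_neq0 C hG _)) // (leq_trans _ hD).
Qed.

(** Apply the previous relation to the all-ones vector of level one. *)
Lemma p22E : c 2 * p22 = c 2 * (b 3 - 1) + (c 3 - 1) * k.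
Proof.
have := congr1 (mulmx^~ (E 1 *m J)) local_adj_up.
rewrite mulmxDl -!scalemxAl -!mulmxA [E 1 *m (E 1 *m J)]mulmxA dual_idem_id.
rewrite level_up_J [J *m (E 1 *m J)]mulmxA J_dual_J sphere_size1 -!scalemxAr.
have -> : E 2 *m (dmx 2 *m (E 2 *m (E 2 *m J))) = p22 *: (E 2 *m J).
  by rewrite -local_adj_J /local_adj !mulmxA.
rewrite !scalerA -scalerDl => /eqP.
rewrite -subr_eq0 -scalerBl scaler_eq0 (negbTE dual2_J_neq0) orbF subr_eq0.
by move/eqP => ->; rewrite [c 2 * _]mulrC.
Qed.

(** If [b 2 = 1] then [c 2 = c 3 = k - 1] and [(k - 1) p22 = (k - 1)^2 - 1], so
    that [k - 1] divides [1]. *)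
Lemma bnum2_neq1 : (3 <= valency e)%N -> b 2 != 1.
Proof.
move=> k3; rewrite pnatr_eq1; apply/eqP => b2.
have D2 : (2 <= D)%N by rewrite (leq_trans _ hD).
have D3 : (3 <= D)%N by rewrite (leq_trans _ hD).
have c2 : (cnum e 2).+1 = valency e.
  apply/eqP; have /eqP := bnumE C hG D2; rewrite b2 eq_sym subr_eq -natrD eqr_nat add1n.
  by rewrite eq_sym.
have bc3 : (bnum e 3 + cnum e 3)%N = valency e.
  apply/eqP; have /eqP := bnumE C hG D3; rewrite eq_sym subr_eq -natrD eqr_nat.
  by rewrite eq_sym.
have b3 := bnum_gt0 hG hD; have c23 := cnum23 hG.
have c3 : cnum e 3 = cnum e 2 by lia.
have b31 : bnum e 3 = 1%N by lia.
have := p22E; rewrite b31 subrr mulr0 add0r c3 -c2 => /eqP.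
have c2_gt0 : (0 < cnum e 2)%N by rewrite (cnum_gt0 hG) // (leq_trans _ hD).
rewrite -[X in _ - X]/(1%:R) -natrB // -!natrM eqr_nat => /eqP.
move: (pnum e 2 2 2) (cnum e 2) c2 k3 => p m <- {c3 b31 bc3 c23 b2 c2_gt0 b3} m2 E1.
have [pm|mp] := leqP p m.-1; nia.
Qed.

End Projection.

(** * A trace over the local space *)

Section Trace.
Variables (C : numClosedFieldType) (X : finType) (e : rel X).
Hypothesis hG : bipartite_drg e.
Variable x : X.

Let hgraph : simple_connected_graph e. Proof. by case: hG. Qed.
Let hD : (4 <= diameter e)%N. Proof. by case: hG. Qed.

Local Notation dist := (dist e).
Local Notation D := (diameter e).
Local Notation b i := ((bnum e i)%:R : C).
Local Notation c i := ((cnum e i)%:R : C).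
Local Notation k := ((valency e)%:R : C).
Local Notation p22 := ((pnum e 2 2 2)%:R : C).
Local Notation A := (adjmx C e).
Local Notation radial := (@radial C X e).
Local Notation E := (dual_idem C e x).
Local Notation B := (local_adj C e x).
Local Notation J := (radial (fun=> 1)).
Local Notation local_space := (local_space e x).
Local Notation tilde := (@tilde C X e).
Local Notation theta := (theta C e).

Let b1 : b 1 != 0. Proof. by rewrite (bnum_neq0 C hG) // (leq_trans _ hD). Qed.
Let b2 : b 2 != 0. Proof. by rewrite (bnum_neq0 C hG) // (leq_trans _ hD). Qed.
Let c2 : c 2 != 0. Proof. by rewrite (cnum_neq0 C hG) //= (leq_trans _ hD). Qed.

Local Notation G := (E 2 *m A *m E 1 *m A *m E 2).
Local Notation J22 := (E 2 *m J *m E 2).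
Local Notation g := (c 2 * (c 2 - 1) / (b 2 * b 1)).

(** The projection onto [local_space]: by [down_up] the columns of
    [E 2 A E 1] have Gram matrix [b 2 + (c 2 - 1) J], whose inverse gives the two corrections. *)
Definition local_proj : 'M[C]_#|X| := E 2 - (b 2)^-1 *: G + g *: J22.
Local Notation Pi := local_proj.

Lemma lower_local_proj : E 1 *m A *m Pi = 0.
Proof.
have E12 : E 1 *m A *m G = b 2 *: (E 1 *m A *m E 2) +
    ((c 2 - 1) * c 2) *: (E 1 *m J *m E 2).
  have JE : E 1 *m J *m E 1 *m A *m E 2 = c 2 *: (E 1 *m J *m E 2).
    have := congr1 (mulmx (E 1)) (J_level_up C hG x 1).
    by rewrite -scalemxAr !mulmxA.
  by rewrite !mulmxA (down_up C hG) !mulmxDl -!scalemxAl JE scalerA.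
have E1J : E 1 *m A *m J22 = b 1 *: (E 1 *m J *m E 2).
  have := congr1 (mulmx^~ (E 2)) (level_down_J C hG x 1).
  by rewrite -scalemxAl !mulmxA.
rewrite /Pi mulmxDr mulmxBr -!scalemxAr E12 E1J scalerDr !scalerA mulVf // scale1r.
set M := E 1 *m A *m _; set N := E 1 *m J *m _.
by apply/matrixP => y z; rewrite !mxE; field; rewrite b1 b2.
Qed.

Lemma dual2_local_proj : E 2 *m Pi = Pi.
Proof.
rewrite /Pi mulmxDr mulmxBr -!scalemxAr !mulmxA dual_idem_id.
by [].
Qed.

Lemma local_proj_space (y : 'cV_#|X|) : local_space (Pi *m y).
Proof.
split; first by rewrite mulmxA dual2_local_proj.
by rewrite !mulmxA lower_local_proj mul0mx.
Qed.

Lemma local_proj_id v : local_space v -> Pi *m v = v.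
Proof.
move=> vU; have [v2 v1] := vU.
rewrite /Pi mulmxDl mulmxBl -!scalemxAl -!mulmxA v2 v1 (local_sum0 hG vU).
by rewrite !mulmx0 !scaler0 subr0 addr0.
Qed.

Lemma local_proj_selfadj : selfadj Pi.
Proof.
have sE i : selfadj (E i) := dual_idem_selfadj e x i.
have sA : selfadj A by apply: selfadj_real_sym; [exact: adj_sym | exact: adj_real].
have sJ : selfadj J by apply: (selfadj_radial hG) => j; rewrite conjC1.
have br : (b 2)^-1^* = (b 2)^-1 by rewrite fmorphV /= conjC_nat.
have gr : g^* = g.
  by rewrite !rmorphM /= fmorphV /= rmorphM rmorphB /= conjC1 !conjC_nat.
move=> u v; rewrite /Pi !mulmxDl !mulNmx -!scalemxAl.
rewrite !hdotDr hdotNr !hdotZr !hdotDl -[- _ in RHS]scaleN1r !hdotZl.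
rewrite rmorphN1 br gr mulN1r -!mulmxA.
by rewrite !(sE, sA, sJ).
Qed.

Lemma local_adj_G : B *m G = (b 3 - 1) *: G + ((c 3 - 1) * c 2) *: J22.
Proof.
have := congr1 (fun M => M *m A *m E 2) (local_adj_up C hG x).
rewrite !mulmxDl -!scalemxAl.
have -> : E 2 *m J *m E 1 *m A *m E 2 = c 2 *: J22.
  have := congr1 (mulmx (E 2)) (J_level_up C hG x 1).
  by rewrite -scalemxAr !mulmxA.
by rewrite scalerA; move: B => B' <-; rewrite !mulmxA.
Qed.

Lemma local_adj_J22 : B *m J22 = p22 *: J22.
Proof.
have := congr1 (mulmx^~ (E 2)) (local_adj_J C hG x).
by rewrite -scalemxAl; move: B => B' <-; rewrite !mulmxA.
Qed.

Local Notation k2 := (sphere_size C e x 2).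

Lemma sphere_size2E : k2 = k * b 1 / c 2.
Proof. by rewrite -(sphere_size2 C hG x) mulrC mulKf. Qed.

Lemma trace_J22 : \tr J22 = k2.
Proof. by rewrite mxtrace_mulC mulmxA dual_idem_id trace_dual_J. Qed.

Lemma trace_G : \tr G = k * (k - 1).
Proof.
have E11 : E 1 = E 1 *m E 1 by rewrite dual_idem_id.
rewrite mxtrace_mulC !mulmxA dual_idem_id -mulmxA mxtrace_mulC E11.
rewrite -!mulmxA mxtrace_mulC !mulmxA (down_up C hG) mxtraceD !mxtraceZ.
rewrite [\tr (E 1 *m J *m _)]mxtrace_mulC mulmxA dual_idem_id.
rewrite trace_dual_idem trace_dual_J (sphere_size1 C hG).
rewrite (bnumE C hG (_ : 2 <= D)%N) ?(leq_trans _ hD) //.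
by ring.
Qed.

Lemma trace_local_adj : \tr B = 0.
Proof.
apply: big1 => y _; rewrite mul_dual_idem dual_idem_mul !mxE (distxx hgraph).
by rewrite mulr0 mul0r.
Qed.

Lemma local_adj_dual2 : B *m E 2 = B.
Proof. by rewrite /local_adj -mulmxA dual_idem_id. Qed.

Lemma trace_local_adj2 : \tr (B *m B) = p22 * k2.
Proof.
have -> : p22 * k2 = \tr (B *m (E 2 *m J)).
  by rewrite (local_adj_J C hG) mxtraceZ trace_dual_J.
have -> : B *m (E 2 *m J) = B *m J.
  by rewrite mulmxA local_adj_dual2.
apply: eq_bigr => y _; rewrite !mxE; apply: eq_bigr => z _.
rewrite [J _ _]mxE mulr1 !mul_dual_idem !dual_idem_mul !mxE.
rewrite (dist_sym hgraph (enum_val z)).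
by case: (_ == _); case: (_ == _); case: (_ == _); rewrite !(mulr1, mulr0, mul0r).
Qed.

(** Each of [B], [B^2] times the projection is a combination of [B], [B^2], [G] and
    [J22], whose traces are known. *)
Lemma trace_local_product (al be : C) :
  \tr ((B - al%:M) *m (B - be%:M) *m Pi) =
  (p22 * k2 - (b 2)^-1 * ((b 3 - 1) * ((b 3 - 1) * (k * (k - 1)) + (c 3 - 1) * c 2 * k2)
      + (c 3 - 1) * c 2 * (p22 * k2)) + g * (p22 * (p22 * k2)))
  - (al + be) * (- (b 2)^-1 * ((b 3 - 1) * (k * (k - 1)) + (c 3 - 1) * c 2 * k2)
      + g * (p22 * k2))
  + al * be * (k2 - (b 2)^-1 * (k * (k - 1)) + g * k2).
Proof.
have BPi : B *m Pi = B - (b 2)^-1 *: (B *m G) + g *: (B *m J22).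
  by rewrite /Pi mulmxDr mulmxBr -!scalemxAr local_adj_dual2.
have tBPi : \tr (B *m Pi) = - (b 2)^-1 * ((b 3 - 1) * (k * (k - 1)) +
    (c 3 - 1) * c 2 * k2) + g * (p22 * k2).
  rewrite BPi mxtraceD raddfB /= !mxtraceZ trace_local_adj local_adj_G local_adj_J22.
  by rewrite mxtraceD !mxtraceZ trace_G trace_J22 sub0r mulNr.
have tPi : \tr Pi = k2 - (b 2)^-1 * (k * (k - 1)) + g * k2.
  by rewrite /Pi mxtraceD raddfB /= !mxtraceZ trace_G trace_J22 trace_dual_idem.
have tBBPi : \tr (B *m B *m Pi) = p22 * k2 - (b 2)^-1 * ((b 3 - 1) *
      ((b 3 - 1) * (k * (k - 1)) + (c 3 - 1) * c 2 * k2)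
      + (c 3 - 1) * c 2 * (p22 * k2)) + g * (p22 * (p22 * k2)).
  rewrite -mulmxA BPi mulmxDr mulmxBr -!scalemxAr local_adj_J22 local_adj_G.
  rewrite mulmxDr -!scalemxAr local_adj_J22 local_adj_G.
  rewrite mxtraceD raddfB /= !mxtraceZ trace_local_adj2 mxtraceD !mxtraceZ mxtraceD !mxtraceZ.
  by rewrite trace_G trace_J22.
rewrite -tBBPi -tBPi -tPi.
have -> : (B - al%:M) *m (B - be%:M) *m Pi =
    B *m B *m Pi - (al + be) *: (B *m Pi) + (al * be) *: Pi.
  rewrite mulmxBl !mulmxBr !mul_scalar_mx !mul_mx_scalar !mulmxBl -!scalemxAl.
  rewrite mul_scalar_mx scalerA scalerDl opprB opprD.
  by apply/matrixP => y z; rewrite !mxE; ring.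
by rewrite mxtraceD raddfB /= !mxtraceZ.
Qed.

End Trace.

(** * The taut equality as an identity on the local space *)

Section TautCriterion.
Variables (C : numClosedFieldType) (X : finType) (e : rel X).
Hypothesis hG : bipartite_drg e.

Let hD : (4 <= diameter e)%N. Proof. by case: hG. Qed.

Hypothesis hodd : odd (diameter e).
Hypothesis hk : (3 <= valency e)%N.

Local Notation D := (diameter e).
Local Notation d := (D./2).
Local Notation b i := ((bnum e i)%:R : C).
Local Notation c i := ((cnum e i)%:R : C).
Local Notation k := ((valency e)%:R : C).
Local Notation p22 := ((pnum e 2 2 2)%:R : C).
Local Notation tilde := (@tilde C X e).
Local Notation theta := (theta C e).
Local Notation B := (local_adj C e).

(** Here [b 2 - 1] is, up to a nonzero factor, the dimension of the local space. *)
Lemma trace_taut x s u (al := - 1 - b 2 * b 3 * (s ^+ 2 - b 2)^-1)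
    (be := - 1 - b 2 * b 3 * (u ^+ 2 - b 2)^-1) :
  s ^+ 2 - b 2 != 0 -> u ^+ 2 - b 2 != 0 ->
  \tr ((B x - al%:M) *m (B x - be%:M) *m local_proj C e x) *
    ((s ^+ 2 - b 2) * (u ^+ 2 - b 2) * (b 2 - 1) * c 2) =
  k * b 3 * (b 3 * (b 2 * (k - 2) - (c 2 - 1) * s ^+ 2)
      * (b 2 * (k - 2) - (c 2 - 1) * u ^+ 2)
    - b 1 * Delta C e * (s ^+ 2 - b 2) * (b 2 - u ^+ 2)).
Proof.
move=> s0 u0; rewrite (trace_local_product hG) (sphere_size2E C hG) /Delta.
have D2 : (2 <= D)%N by rewrite (leq_trans _ hD).
have D3 : (3 <= D)%N by rewrite (leq_trans _ hD).
have b10 : b 1 != 0 by rewrite (bnum_neq0 C hG).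
have b20 : b 2 != 0 by rewrite (bnum_neq0 C hG).
have c20 : c 2 != 0 by rewrite (cnum_neq0 C hG).
have -> : p22 = b 3 - 1 + (c 3 - 1) * k / c 2.
  by apply: (mulfI c20) => /=; rewrite (p22E C hG x); field.
have c3E : c 3 = k - b 3 by rewrite (bnumE C hG D3) opprB addrC subrK.
have b2E := bnumE C hG D2; have b1E := bnumE C hG (diam_gt0 hG).
rewrite (cnum1 hG) in b1E.
rewrite /al /be c3E; move: s0 u0 b10 b20 c20; rewrite b2E b1E => s0 u0 b10 b20 c20.
field; exact/and5P.
Qed.

Local Notation alpha := (tilde (theta 1)).
Local Notation beta := (tilde (theta d)).
Local Notation Q x := ((B x - alpha%:M) *m (B x - beta%:M)).

Lemma local_product_space x v : local_space e x v -> local_space e x (Q x *m v).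
Proof. by move=> vU; rewrite -mulmxA; do 2![apply: local_space_shift => //]. Qed.

(** The trace of [Q] over [local_space] is a sum of nonpositive numbers. *)
Lemma trace_local_product_eq0 x : \tr (Q x *m local_proj C e x) = 0 <->
  (forall v, local_space e x v -> Q x *m v = 0).
Proof.
set Pi := local_proj C e x.
pose dl y : 'cV[C]_#|X| := delta_mx y 0.
have entry y : (Q x *m Pi) y y = hdot (Pi *m dl y) (Q x *m (Pi *m dl y)).
  rewrite -(local_proj_selfadj hG) (local_proj_id hG); last first.
    by apply: local_product_space; apply: local_proj_space.
  by rewrite /dl hdot_delta mulmxA -colE [RHS]mxE.
split=> [tr0 v vU|Q0]; last first.
  by apply: big1 => y _; rewrite entry Q0 ?hdot0r //; apply: local_proj_space.
have le0 y := local_product_le0 hG hodd (local_proj_space hG x (dl y)).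
have : \sum_y - (Q x *m Pi) y y = 0 by rewrite sumrN -[X in - X]/(\tr _) tr0 oppr0.
move/eqP; rewrite psumr_eq0 => [/allP z0|y _]; last first.
  by rewrite entry oppr_ge0; have [] := le0 y.
suff QPi : Q x *m Pi = 0 by rewrite -(local_proj_id hG vU) mulmxA QPi mul0mx.
apply/matrixP => z y; rewrite [RHS]mxE.
have [_ eq0] := le0 y.
have {}eq0 : Q x *m (Pi *m dl y) = 0.
  apply: eq0; rewrite -entry; apply/eqP; rewrite -oppr_eq0.
  exact: z0 (mem_index_enum y).
have -> : (Q x *m Pi) z y = (Q x *m (Pi *m dl y)) z 0.
  by rewrite /dl mulmxA -colE [RHS]mxE.
by rewrite eq0 mxE.
Qed.

Lemma taut_criterion x :
  b 3 * (b 2 * (k - 2) - (c 2 - 1) * theta 1 ^+ 2)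
      * (b 2 * (k - 2) - (c 2 - 1) * theta d ^+ 2)
  = b 1 * Delta C e * (theta 1 ^+ 2 - b 2) * (b 2 - theta d ^+ 2) <->
  (forall v, local_space e x v -> Q x *m v = 0).
Proof.
have d0 : (d <= D)%N by lia.
have s0 : theta 1 ^+ 2 - b 2 != 0.
  apply: (sqr_sub_bnum2_neq0 hG); last by rewrite gt_eqF // theta1_gap2.
  by rewrite (eigenvalue_theta C hG) // (diam_gt0 hG).
have u0 : theta d ^+ 2 - b 2 != 0.
  apply: (sqr_sub_bnum2_neq0 hG); last by rewrite lt_eqF // theta_half_gap2.
  exact: (eigenvalue_theta C hG).
have := trace_taut x s0 u0; rewrite -trace_local_product_eq0.
have c20 : c 2 != 0 by rewrite (cnum_neq0 C hG) //= (leq_trans _ hD).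
have kb : k * b 3 != 0 by rewrite mulf_neq0 // (bnum_neq0 C hG) // (diam_gt0 hG).
have b21 : b 2 - 1 != 0 by rewrite subr_eq0 (bnum2_neq1 C hG x).
set l := b 3 * _ * _; set r := b 1 * _ * _ * _ => trE; split=> [lr|tr0].
  apply/eqP; move/eqP: trE; rewrite lr subrr mulr0 mulf_eq0.
  by rewrite (negbTE (mulf_neq0 _ c20)) ?orbF // !mulf_neq0.
move/eqP: trE; rewrite /alpha /beta in tr0; rewrite tr0 mul0r eq_sym mulf_eq0.
by rewrite (negbTE kb) /= subr_eq0 => /eqP.
Qed.

End TautCriterion.

(** * Thin modules of endpoint two *)

Section Modules.
Variables (C : numClosedFieldType) (X : finType) (e : rel X).
Hypothesis hG : bipartite_drg e.
Variable x : X.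

Let hD : (4 <= diameter e)%N. Proof. by case: hG. Qed.

Local Notation D := (diameter e).
Local Notation A := (adjmx C e).
Local Notation E := (dual_idem C e x).
Local Notation V := 'cV[C]_#|X|.
Implicit Types W U M : {vspace V}.

(** The adjacency matrix and the [E i] generate the algebra. *)
Lemma TmoduleP W :
  Tmodule e x W <-> (forall w, w \in W -> A *m w \in W) /\
                    (forall i w, w \in W -> E i *m w \in W).
Proof.
split=> [mW|[AW EW] B TB].
  split=> [w wW|i w wW]; first exact: mW (Talg_adj C e x) w wW.
  have [iD|Di] := leqP i D; first exact: mW (Talg_dual C x iD) w wW.
  by rewrite dual_idem_big // mul0mx mem0v.
elim: TB => [|i _||a M _ IHM|M N _ IHM _ IHN|M N _ IHM _ IHN] => //.
- by move=> w wW; apply: EW.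
- by move=> w; rewrite mul1mx.
- by move=> w wW; rewrite -scalemxAl memvZ ?IHM.
- by move=> w wW; rewrite mulmxDl memvD ?IHM ?IHN.
- by move=> w wW; rewrite -mulmxA IHM ?IHN.
Qed.

Lemma mem_dual_part i W w : w \in W -> E i *m w \in dual_part e x i W.
Proof. by move=> wW; rewrite -[E i *m w](lfunE (mulmx (E i))) memv_img. Qed.

Lemma dual_partP i W w :
  reflect (exists2 u, u \in W & w = E i *m u) (w \in dual_part e x i W).
Proof.
by apply: (iffP memv_imgP) => -[u uW ->]; exists u; rewrite ?lfunE.
Qed.

Lemma dual_part_eq0 i W : dual_part e x i W = 0%VS ->
  forall w, w \in W -> E i *m w = 0.
Proof. by move=> W0 w /(mem_dual_part i); rewrite W0 memv0 => /eqP. Qed.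

Lemma endpoint2P W : endpoint e x W = 2 ->
  [/\ dual_part e x 0 W = 0%VS, dual_part e x 1 W = 0%VS &
      dual_part e x 2 W != 0%VS].
Proof.
rewrite /endpoint => W2.
have hP : has (fun i => dual_part e x i W != 0%VS) (iota 0 D.+1).
  by rewrite has_find W2 size_iota ltnS (leq_trans _ hD).
have W0 i : (i < 2)%N -> dual_part e x i W = 0%VS.
  move=> i2; have := before_find 0%N (a := fun i => dual_part e x i W != 0%VS)
    (s := iota 0 D.+1) (i := i).
  rewrite W2 nth_iota; first by move/(_ i2)/eqP.
  by rewrite ltnS ltnW // (leq_trans i2) // (leq_trans _ hD).
split; [exact: W0 | exact: W0 |]; have := nth_find 0%N hP.
by rewrite W2 nth_iota // ltnS (leq_trans _ hD).
Qed.

Lemma endpoint2I W : dual_part e x 0 W = 0%VS -> dual_part e x 1 W = 0%VS ->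
  dual_part e x 2 W != 0%VS -> endpoint e x W = 2.
Proof.
move=> W0 W1 W2; rewrite /endpoint.
have -> : D.+1 = (D - 2).+3 by lia.
by rewrite /= W0 W1 eqxx W2.
Qed.

Local Notation local_space := (local_space e x).
Local Notation B := (local_adj C e x).

Lemma local_space_dual W w : Tmodule e x W -> dual_part e x 1 W = 0%VS ->
  w \in W -> local_space (E 2 *m w).
Proof.
move=> /TmoduleP[AW EW] W1 wW; split; first by rewrite mulmxA dual_idem_id.
by apply: (dual_part_eq0 W1); rewrite AW ?EW.
Qed.

(** [A_2] is a polynomial of degree two in [A]. *)
Lemma Tmodule_local_adj W w : Tmodule e x W -> w \in W -> B *m w \in W.
Proof.
move=> /TmoduleP[AW EW] wW; rewrite /local_adj -!mulmxA EW //.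
move: (E 2 *m w) (EW 2 w wW) => {wW}w wW.
have c2 : ((cnum e 2)%:R : C) != 0.
  by rewrite (cnum_neq0 C hG) //= (leq_trans _ hD).
have := congr1 (mulmx^~ w) (adj_distmx C hG 0).
rewrite -mulmxA mulmxDl -!scalemxAl (distmx0 C hG) mul1mx => E2.
have -> : distmx C e 2 *m w =
    ((cnum e 2)%:R)^-1 *: (A *m (A *m w) - (bnum e 0)%:R *: w).
  by rewrite [A *m _]E2 addrC addKr scalerA mulVf ?scale1r.
by rewrite memvZ // memvB ?memvZ // AW ?AW.
Qed.

Lemma Tmodule_local_shift W a w : Tmodule e x W -> w \in W -> (B - a%:M) *m w \in W.
Proof.
by move=> mW wW; rewrite mulmxBl mul_scalar_mx memvB ?memvZ ?Tmodule_local_adj.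
Qed.

(** A nonzero vector killed by [(B - al)(B - be)] is an eigenvector of one factor
    or is mapped by [B - be] to an eigenvector of the other. *)
Lemma local_eigenvector W al be : Tmodule e x W ->
  dual_part e x 1 W = 0%VS -> dual_part e x 2 W != 0%VS ->
  (forall v, local_space v -> (B - al%:M) *m (B - be%:M) *m v = 0) ->
  exists v, [/\ v \in W, v != 0, local_space v &
                B *m v = al *: v \/ B *m v = be *: v].
Proof.
move=> mW W1 W2 Q0; have /TmoduleP[AW EW] := mW.
have := vpick0 (dual_part e x 2 W); rewrite (negbTE W2) => /negbT v0.
have /dual_partP[w wW vE] := memv_pick (dual_part e x 2 W).
rewrite {}vE in v0; have vU := local_space_dual mW W1 wW.
set v := E 2 *m w in v0 vU.
have vW : v \in W by rewrite EW.
have [v1|v1] := eqVneq ((B - be%:M) *m v) 0.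
  exists v; split=> //; right.
  by apply/eqP; rewrite -subr_eq0 -mul_scalar_mx -mulmxBl v1.
exists ((B - be%:M) *m v); split=> //.
- exact: Tmodule_local_shift.
- exact: local_space_shift.
left; apply/eqP; rewrite -subr_eq0 -mul_scalar_mx -mulmxBl mulmxA.
by apply/eqP/Q0.
Qed.

Section Thin.
Variables (t : C) (v : V).
Hypothesis et : eigenvalue A t.
Hypothesis gap0 : forall i, (i.+2 <= D)%N -> cosine_gap e t i != 0.
Hypothesis vU : local_space v.
Hypothesis Bv : B *m v = tilde e t *: v.

Let v2 : E 2 *m v = v. Proof. by case: vU. Qed.
Let v1 : E 1 *m (A *m v) = 0. Proof. by case: vU. Qed.

Local Notation dmx := (distmx C e).
(** The component of [A_i v] on the level farthest from [x]. *)
Definition near_part i := E i.+2 *m (dmx i *m v).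

(** The relations [J v = 0] and [S v = 0], [S] the cosine matrix of [t], leave
    one dimension to the three components of a level. *)
Lemma middle_near i : exists a, E i.+2 *m (dmx i.+2 *m v) = a *: near_part i.
Proof.
have sum0 := level_three_sum0 hG i vU.
have [iD|Di] := leqP i.+4 D; last first.
  move: sum0; rewrite distmx_big // mul0mx mulmx0 => /esym/eqP.
  by rewrite subr_eq0 eq_sym => /eqP ->; exists (-1); rewrite scaleN1r.
have Sv : radial e (cosine e t) *m v = 0.
  by apply/(local_tight hG et _ vU) => //; apply: gap0; rewrite (leq_trans _ hD).
have := level_three hG (cosine e t) i vU.
rewrite Sv mulmx0 sum0 -/(near_part i).
set m := E i.+2 *m (dmx i.+2 *m v) => E0.
have g := gap0 (iD : (i.+2.+2 <= D)%N).
have key : cosine_gap e t i.+2 *: m = (cosine e t i.+4 - cosine e t i) *: near_part i.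
  rewrite /cosine_gap; apply/eqP; rewrite -subr_eq0; apply/eqP; rewrite [RHS]E0.
  by apply/colP => y; rewrite !mxE; ring.
exists ((cosine e t i.+4 - cosine e t i) / cosine_gap e t i.+2).
by rewrite mulrC -scalerA -key scalerA mulVf ?scale1r.
Qed.

Lemma near_up i : exists a, E i.+3 *m (A *m near_part i) = a *: near_part i.+1.
Proof.
have := level_adj hG x i.+2 (dmx i *m v).
rewrite [E i.+4 *m _](level_dist0 hG v2); last by rewrite /admissible; lia.
rewrite !mulmx0 addr0 -/(near_part i) => <-.
case: i => [|i]; first by exists 1; rewrite (distmx0_mul hG) scale1r.
exists (cnum e i.+2)%:R; rewrite [A *m _]mulmxA (adj_distmx C hG) mulmxDl mulmxDr.
rewrite -!scalemxAl -!scalemxAr (level_dist0 hG v2 (i := i.+4)) ?scaler0 ?add0r //.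
by rewrite /admissible; lia.
Qed.

(** The level [i.+1] part of [A A_i v] comes from levels [i.+2] and [i]. The total is
    given by [adj_distmx]. The contribution of level [i] is given by [near_up], the
    component of [A_i v] there being a multiple of [near_part i.-2]. *)
Lemma near_down i : exists a, E i.+1 *m (A *m near_part i) = a *: near_part i.-1.
Proof.
case: i => [|[|i]].
- exists 0; rewrite scale0r /near_part (distmx0_mul hG) v2; exact: v1.
- have [a m0] := middle_near 0.
  have := level_adj hG x 1 (dmx 1 *m v).
  rewrite [E 1 *m (dmx 1 *m v)]v1 !mulmx0 add0r -/(near_part 1) => <-.
  rewrite [A *m _]mulmxA (adj_distmx C hG) mulmxDl mulmxDr -!scalemxAl -!scalemxAr m0.
  exists ((bnum e 0)%:R + (cnum e 2)%:R * a); rewrite scalerDl scalerA.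
  by rewrite /near_part.
have [a m1] := middle_near i.+1; have [a' m0] := middle_near i.
have [a'' up0] := near_up i.
have := level_adj hG x i.+2 (dmx i.+2 *m v).
rewrite -/(near_part i.+2) m0 -scalemxAr -scalemxAr up0.
rewrite [A *m _]mulmxA (adj_distmx C hG) mulmxDl mulmxDr -!scalemxAl -!scalemxAr m1.
rewrite !scalerA -/(near_part i.+1) -scalerDl => H.
exists ((bnum e i.+1)%:R + (cnum e i.+3)%:R * a - a' * a'').
by rewrite scalerBl H addrC addKr.
Qed.

Lemma dual_near_part i : E i.+2 *m near_part i = near_part i.
Proof. by rewrite /near_part mulmxA dual_idem_id. Qed.

Lemma near_part0 : near_part 0 = v.
Proof. by rewrite /near_part (distmx0_mul hG) v2. Qed.

Definition near_space : {vspace V} := <<[seq near_part i | i <- iota 0 D]>>%VS.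

Lemma mem_near_part i : near_part i \in near_space.
Proof.
have [iD|Di] := ltnP i D; first by rewrite memv_span // map_f // mem_iota.
by rewrite /near_part dual_idem_big ?mul0mx ?mem0v // ltnS (leq_trans Di).
Qed.

Lemma near_spaceP (f : 'Hom(V, V)) (M : {vspace V}) :
  (forall i, f (near_part i) \in M) -> forall w, w \in near_space -> f w \in M.
Proof.
move=> fM w wS; have : f w \in (f @: near_space)%VS by rewrite memv_img.
rewrite limg_span -map_comp; apply: subvP; apply/span_subvP => y.
by case/mapP => i _ ->; exact: fM.
Qed.

Lemma dual_near_line h w : w \in near_space -> E h *m w \in <[near_part h.-2]>%VS.
Proof.
rewrite -[E h *m w](lfunE (mulmx (E h))); apply: near_spaceP => i.
rewrite lfunE /= -dual_near_part mulmxA dual_idemM.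
have [->|_] := eqVneq h i.+2; first by rewrite scale1r dual_near_part memv_line.
by rewrite scale0r mul0mx mem0v.
Qed.

Lemma near_space_module : Tmodule e x near_space.
Proof.
apply/TmoduleP; split=> [w|h w].
  rewrite -[A *m w](lfunE (mulmx A)); apply: near_spaceP => i; rewrite lfunE /=.
  rewrite -[A *m _]mul1mx -(sum_dual_idem C e x) mulmx_suml memv_suml // => h _.
  have [->|hu] := eqVneq (h : nat) i.+3.
    by have [a ->] := near_up i; rewrite memvZ ?mem_near_part.
  have [->|hd] := eqVneq (h : nat) i.+1.
    by have [a ->] := near_down i; rewrite memvZ ?mem_near_part.
  rewrite (level_dist0 hG (dual_near_part i) (j := 1)) ?mem0v //.
  by rewrite /admissible; lia.
move=> wS; have := dual_near_line h wS => /vlineP[a ->].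
by rewrite memvZ ?mem_near_part.
Qed.

(** [near_space] is a module that meets [W] and has at most one dimension on each
    level. *)
Lemma thin_of_eigenvector W : Tirreducible e x W -> v \in W -> v != 0 ->
  thin e x W /\ local_eigenvalue e x W (tilde e t).
Proof.
move=> [mW W0 irr] vW v0.
have WS : (W <= near_space)%VS.
  have [] := irr (W :&: near_space)%VS; rewrite ?capvSl //.
  - have /TmoduleP[AW EW] := mW; have /TmoduleP[AS ES] := near_space_module.
    apply/TmoduleP; split=> [w|i w]; rewrite !memv_cap => /andP[wW wS].
      by rewrite AW ?AS.
    by rewrite EW ?ES.
  - move=> W0'; have : v \in (W :&: near_space)%VS.
      by rewrite memv_cap vW -{1}near_part0 mem_near_part.
    by rewrite W0' memv0 (negbTE v0).
  - by move/capv_idPl.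
have line i : (dual_part e x i W <= <[near_part i.-2]>)%VS.
  by apply/subvP => w /dual_partP[u uW ->]; rewrite dual_near_line // (subvP WS).
split=> [i _|w w2].
  by rewrite (leq_trans (dimvS (line i))) // dim_vline leq_b1.
have := subvP (line 2) w w2; rewrite near_part0 => /vlineP[a ->].
by rewrite -/(local_adj C e x) -scalemxAr Bv scalerA mulrC -scalerA.
Qed.

End Thin.
End Modules.

(** * Complete reducibility *)

Section Orthogonal.
Variables (C : numClosedFieldType) (n : nat).
Local Notation V := 'cV[C]_n.
Implicit Types W U M : {vspace V}.

(** The rows are the forms [hdot u] for [u] in a basis of [W], so that its kernel is
    the orthogonal complement. *)
Definition conj_basis W : 'M[C]_(\dim W, n) :=
  \matrix_(i, j) ((vbasis W)`_i j 0)^*.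

Definition orthv W : {vspace V} := lker (linfun (mulmx (conj_basis W))).

Lemma orthvP W w : reflect (forall u, u \in W -> hdot u w = 0) (w \in orthv W).
Proof.
rewrite memv_ker lfunE /=.
have entry i : (conj_basis W *m w) i 0 = hdot (vbasis W)`_i w.
  by rewrite mxE; apply: eq_bigr => j _; rewrite mxE.
apply: (iffP eqP) => [w0 u uW|w0].
  rewrite (coord_vbasis uW).
  elim/big_ind: _ => [|u1 u2 h1 h2|i _]; first by rewrite hdot0l.
    by rewrite hdotDl h1 h2 addr0.
  by rewrite hdotZl -entry w0 mxE mulr0.
apply/colP => i; rewrite entry mxE w0 //.
by rewrite vbasis_mem // mem_nth // size_tuple.
Qed.

Lemma capv_orthv W : (W :&: orthv W)%VS = 0%VS.
Proof.
apply/eqP; rewrite -subv0; apply/subvP => w; rewrite memv_cap => /andP[wW].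
by move=> /orthvP/(_ w wW)/hdot_eq0 ->; rewrite mem0v.
Qed.

Lemma addv_orthv W : (W + orthv W)%VS = fullv.
Proof.
apply/eqP; rewrite eqEdim subvf dimv_disjoint_sum ?capv_orthv //=.
rewrite -(limg_ker_dim (linfun (mulmx (conj_basis W))) fullv) capfv addnC leq_add2r.
apply: leq_trans (dimvS (subvf _)) _.
by rewrite dimvf /dim /= muln1.
Qed.

End Orthogonal.

Section Reducibility.
Variables (C : numClosedFieldType) (X : finType) (e : rel X).
Hypothesis hG : bipartite_drg e.
Variable x : X.

Local Notation dist := (dist e).
Local Notation A := (adjmx C e).
Local Notation radial := (@radial C X e).
Local Notation V := 'cV[C]_#|X|.
Local Notation local_space := (local_space e x).
Implicit Types W U S : {vspace V}.

Lemma adj_selfadj : selfadj A.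
Proof. by apply: selfadj_real_sym; [exact: adj_sym | exact: adj_real]. Qed.

Lemma Tmodule_orthv W : Tmodule e x W -> Tmodule e x (orthv W).
Proof.
move=> /TmoduleP[AW EW]; apply/TmoduleP.
split=> [w|i w] /orthvP wW; apply/orthvP => u uW.
  by rewrite adj_selfadj wW ?AW.
by rewrite dual_idem_selfadj wW ?EW.
Qed.

Lemma Tmodule_cap W U : Tmodule e x W -> Tmodule e x U -> Tmodule e x (W :&: U).
Proof.
move=> mW mU B TB w; rewrite !memv_cap => /andP[wW wU].
by rewrite mW ?mU.
Qed.

Lemma exists_irreducible S : Tmodule e x S -> S != 0%VS ->
  exists2 W, Tirreducible e x W & (W <= S)%VS.
Proof.
have [n] := ubnP (\dim S); elim: n S => // n IHn S dS mS S0.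
have [irr|nirr] := boolp.EM (Tirreducible e x S); first by exists S.
have [U [mU US U0 UneS]] : exists U : {vspace V},
    [/\ Tmodule e x U, (U <= S)%VS, U != 0%VS & U != S].
  apply: boolp.contrapT => noU; apply: nirr; split=> // U mU US.
  have [->|U0] := eqVneq U 0%VS; first by left.
  have [->|UneS] := eqVneq U S; first by right.
  by case: noU; exists U.
have dUS : (\dim U < \dim S)%N.
  rewrite ltn_neqAle dimvS // andbT; apply: contra UneS => /eqP dUS.
  by rewrite eqEdim US dUS leqnn.
have [W irrW WU] := IHn U (leq_trans dUS (ltnSE dS)) mU U0.
by exists W => //; apply: subv_trans WU US.
Qed.

(** Complete reducibility: split off an irreducible submodule and its orthogonal
    complement. *)
Lemma irreducible_ind (P : V -> Prop) S :
  P 0 -> (forall u v, P u -> P v -> P (u + v)) -> Tmodule e x S ->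
  (forall W, Tirreducible e x W -> (W <= S)%VS -> forall w, w \in W -> P w) ->
  forall w, w \in S -> P w.
Proof.
move=> P0 PD mS; have [n] := ubnP (\dim S); elim: n S mS => // n IHn S mS dS PS w wS.
have [S0|S0] := eqVneq S 0%VS; first by move: wS; rewrite S0 memv0 => /eqP ->.
have [W irrW WS] := exists_irreducible mS S0; have [mW W0 _] := irrW.
have : w \in (W + orthv W)%VS by rewrite addv_orthv memvf.
case/memv_addP => u uW [v vW wE]; rewrite wE; apply: PD; first exact: PS uW.
have vS : v \in (S :&: orthv W)%VS.
  rewrite memv_cap vW andbT; have -> : v = w - u by rewrite wE addrC addKr.
  by rewrite memvB // (subvP WS).
apply: (IHn (S :&: orthv W)%VS) vS; first exact: Tmodule_cap (Tmodule_orthv mW).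
  rewrite -ltnS (leq_trans _ dS) // ltnS.
  rewrite ltn_neqAle dimvS ?capvSl // andbT; apply: contra W0 => /eqP dE.
  have SE : (S :&: orthv W)%VS = S by apply/eqP; rewrite eqEdim capvSl dE leqnn.
  rewrite -subv0 -(capv_orthv W) subv_cap subvv /=.
  by rewrite (subv_trans WS) // -SE capvSr.
by move=> W' irrW' W'S; apply: PS => //; apply: subv_trans W'S (capvSl _ _).
Qed.

End Reducibility.

(** * The module generated by levels zero and one *)

Section EndpointOne.
Variables (C : numClosedFieldType) (X : finType) (e : rel X).
Hypothesis hG : bipartite_drg e.
Variable x : X.

Let hgraph : simple_connected_graph e. Proof. by case: hG. Qed.

Local Notation dist := (dist e).
Local Notation D := (diameter e).
Local Notation b i := ((bnum e i)%:R : C).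
Local Notation c i := ((cnum e i)%:R : C).
Local Notation A := (adjmx C e).
Local Notation dmx := (distmx C e).
Local Notation radial := (@radial C X e).
Local Notation J := (radial (fun=> 1)).
Local Notation E := (dual_idem C e x).
Local Notation V := 'cV[C]_#|X|.
Local Notation local_space := (local_space e x).
Implicit Types W U S : {vspace V}.

Definition ones : V := const_mx 1.
(** The vertices of level [i] at distance [i.-1] from a neighbour [y] of [x]; zero
    when [y] is not a neighbour of [x]. *)
Definition shell i y : V := E i *m (dmx i.-1 *m (E 1 *m delta_mx y 0)).

(** The sum of the irreducible modules with endpoint zero or one, by generators. *)
Definition low_space : {vspace V} :=
  <<[seq shell i y | i <- iota 0 D.+1, y <- enum 'I_#|X|] ++
    [seq E i *m ones | i <- iota 0 D.+1]>>%VS.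

Lemma mem_shell i y : shell i y \in low_space.
Proof.
have [iD|Di] := leqP i D; last by rewrite /shell dual_idem_big // mul0mx mem0v.
apply: memv_span; rewrite mem_cat; apply/orP; left.
by apply: allpairs_f; rewrite ?mem_iota ?mem_enum.
Qed.

Lemma mem_ones i : E i *m ones \in low_space.
Proof.
have [iD|Di] := leqP i D; last by rewrite dual_idem_big // mul0mx mem0v.
apply: memv_span; rewrite mem_cat; apply/orP; right.
by apply/mapP; exists i; rewrite ?mem_iota.
Qed.

Lemma low_spaceP (f : 'Hom(V, V)) (M : {vspace V}) :
  (forall i y, f (shell i y) \in M) -> (forall i, f (E i *m ones) \in M) ->
  forall w, w \in low_space -> f w \in M.
Proof.
move=> fM fM' w wS; have : f w \in (f @: low_space)%VS by rewrite memv_img.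
rewrite limg_span; apply: subvP; apply/span_subvP => u /mapP[v + ->].
rewrite mem_cat => /orP[/allpairsP[[i y] [_ _ ->]]|/mapP[i _ ->]]; [exact: fM | exact: fM'].
Qed.

Lemma J_mul (u : V) : J *m u = (\sum_z u z 0) *: ones.
Proof.
apply/colP => y; rewrite !mxE mulr1; apply: eq_bigr => z _.
by rewrite mxE mul1r.
Qed.

Lemma J_delta : J *m delta_mx (enum_rank x) 0 = ones.
Proof. by apply/colP => y; rewrite -colE !mxE. Qed.

Lemma up_ones i : E i.+1 *m (A *m (E i *m ones)) = c i.+1 *: (E i.+1 *m ones).
Proof.
rewrite -J_delta; have := congr1 (mulmx^~ (delta_mx (enum_rank x) 0 : V)) (level_up_J C hG x i).
by rewrite /= -scalemxAl -!mulmxA.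
Qed.

Lemma down_ones i : E i *m (A *m (E i.+1 *m ones)) = b i *: (E i *m ones).
Proof.
rewrite -J_delta; have := congr1 (mulmx^~ (delta_mx (enum_rank x) 0 : V)) (level_down_J C hG x i).
by rewrite /= -scalemxAl -!mulmxA.
Qed.

Lemma low_space0 (w : V) : E 0 *m w \in low_space.
Proof.
have -> : E 0 *m w = w (enum_rank x) 0 *: (E 0 *m ones).
  apply/colP => y; rewrite dual_idem_mul mxE dual_idem_mul mxE mulr1 mulrC.
  case: eqP => [d0|]; last by rewrite !mulr0.
  have /(dist0P hgraph) xy : dist x (enum_val y) == 0%N by apply/eqP.
  by rewrite [in RHS]xy enum_valK.
by rewrite memvZ ?mem_ones.
Qed.

Lemma low_space1 (w : V) : E 1 *m w \in low_space.
Proof.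
rewrite [w]matrix_sum_delta mulmx_sumr memv_suml // => y _.
rewrite mulmx_sumr memv_suml // => j _; rewrite ord1 -scalemxAr memvZ //.
by have := mem_shell 1 y; rewrite /shell (distmx0_mul hG) mulmxA dual_idem_id.
Qed.

Lemma shell_up i y : exists a, E i.+2 *m (A *m shell i.+1 y) = a *: shell i.+2 y.
Proof.
pose u : V := E 1 *m delta_mx y 0; have u1 : E 1 *m u = u by rewrite mulmxA dual_idem_id.
have := level_adj hG x i.+1 (dmx i *m u).
rewrite [E i.+3 *m _](level_dist0 hG u1); last by rewrite /admissible; lia.
rewrite !mulmx0 addr0 /shell -/u /= => <-.
case: i => [|i]; first by exists 1; rewrite (distmx0_mul hG) scale1r.
exists (c i.+2); rewrite [A *m _]mulmxA (adj_distmx C hG) mulmxDl mulmxDr.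
rewrite -!scalemxAl -!scalemxAr (level_dist0 hG u1 (i := i.+3)) ?scaler0 ?add0r //.
by rewrite /admissible; lia.
Qed.

(** Level [i.+1] is at distance [i] or [i.+2] from a neighbour of [x]. *)
Lemma shell_complement i y : exists s,
  E i.+1 *m (dmx i.+2 *m (E 1 *m (delta_mx y 0 : V))) = s *: (E i.+1 *m ones) - shell i.+1 y.
Proof.
pose u : V := E 1 *m delta_mx y 0; have u1 : E 1 *m u = u by rewrite mulmxA dual_idem_id.
rewrite -/u; exists (\sum_z u z 0).
have := level_radial hG (i := i.+1) (w := fun=> 1)
  (w' := fun j => (j == i)%:R + (j == i.+2)%:R) u1.
rewrite -radialD mulmxDl mulmxDr -!distmxE J_mul -scalemxAr => ->.
  by rewrite /shell -/u /= addrAC subrr add0r.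
move=> j _ /and4P[]; rewrite !addn1 => ij _ ji par.
have [->|->] : j = i \/ j = i.+2.
  move: ij ji par; rewrite ltnS => ij ji; have [m jE] : exists m, j = (i + m)%N.
    by exists (j - i)%N; rewrite subnKC.
  rewrite jE in ji *; case: m {jE} ji => [|[|[|m]]] ji par.
  - by left; rewrite addn0.
  - by exfalso; move: par; rewrite addn1 !addSn addnS /= negbK oddD addbb.
  - by right; rewrite addn2.
  - by exfalso; lia.
- by rewrite eqxx (@ltn_eqF i i.+2) // addr0.
- by rewrite eqxx (@gtn_eqF i i.+2) // add0r.
Qed.

(** With [u = E 1 y], the level [i.+2] part of [A A_(i+2) u] comes from levels [i.+1]
    and [i.+3]; [shell_complement] expresses the total and the contribution of level
    [i.+1] by shells. *)
Lemma shell_down i y : E i.+2 *m (A *m shell i.+3 y) \in low_space.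
Proof.
have [a up] := shell_up i y.
have [s1 c1] := shell_complement i y; have [s2 c2] := shell_complement i.+1 y.
set u : V := E 1 *m delta_mx y 0 in c1 c2.
have := level_adj hG x i.+1 (dmx i.+2 *m u).
rewrite c1 mulmxBr mulmxBr up -!scalemxAr up_ones.
rewrite [A *m (dmx i.+2 *m u)]mulmxA (adj_distmx C hG) mulmxDl mulmxDr.
rewrite -!scalemxAl -!scalemxAr c2 -[E i.+2 *m (dmx i.+1 *m u)]/(shell i.+2 y).
rewrite -/(shell i.+3 y) => H.
have -> : E i.+2 *m (A *m shell i.+3 y) =
    b i.+1 *: shell i.+2 y + c i.+3 *: (s2 *: (E i.+2 *m ones) - shell i.+2 y)
    - (s1 *: (c i.+2 *: (E i.+2 *m ones)) - a *: shell i.+2 y).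
  by rewrite H addrC addKr.
by rewrite !(memvB, memvD, memvZ, mem_shell, mem_ones).
Qed.

Lemma low_space_module : Tmodule e x low_space.
Proof.
apply/TmoduleP; split=> [w|h w].
  rewrite -[A *m w](lfunE (mulmx A)); apply: low_spaceP => [i y|i]; rewrite lfunE /=.
    rewrite -[A *m _]mul1mx -(sum_dual_idem C e x) mulmx_suml memv_suml // => h _.
    case: (nat_of_ord h) => [|[|{}h]]; [exact: low_space0 | exact: low_space1 |].
    have dE : E i *m shell i y = shell i y by rewrite /shell mulmxA dual_idem_id.
    have [->|iu] := eqVneq i h.+1.
      by have [a ->] := shell_up h y; rewrite memvZ ?mem_shell.
    have [->|id] := eqVneq i h.+3; first exact: shell_down.
    rewrite (level_dist0 hG dE (j := 1)) ?mem0v //.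
    by rewrite /admissible; lia.
  rewrite -[A *m _]mul1mx -(sum_dual_idem C e x) mulmx_suml memv_suml // => h _.
  case: (nat_of_ord h) => [|{}h]; first exact: low_space0.
  have dE : E i *m (E i *m ones) = E i *m ones by rewrite mulmxA dual_idem_id.
  have [->|iu] := eqVneq i h; first by rewrite up_ones memvZ ?mem_ones.
  have [->|id] := eqVneq i h.+2; first by rewrite down_ones memvZ ?mem_ones.
  rewrite (level_dist0 hG dE (j := 1)) ?mem0v //.
  by rewrite /admissible; lia.
rewrite -[E h *m w](lfunE (mulmx (E h))); apply: low_spaceP => [i y|i]; rewrite lfunE /=.
  rewrite /shell [E h *m (E i *m _)]mulmxA dual_idemM.
  have [->|_] := eqVneq h i; last by rewrite scale0r mul0mx mem0v.
  by rewrite scale1r mem_shell.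
rewrite [E h *m (E i *m _)]mulmxA dual_idemM.
have [->|_] := eqVneq h i; last by rewrite scale0r mul0mx mem0v.
by rewrite scale1r mem_ones.
Qed.

Lemma dmx_selfadj j : selfadj (dmx j).
Proof. by rewrite distmxE; apply: (selfadj_radial hG) => h; rewrite conjC_nat. Qed.

(** On level two [low_space] is spanned by [A E 1 y] and the all-ones vector. *)
Lemma local_space_low v : local_space v -> v \in orthv low_space.
Proof.
move=> vU; have [v2 v1] := vU; apply/orthvP => u uN.
have v0 i : i != 2%N -> E i *m v = 0 by exact: dual_idem_eq0 v2.
suff uO : u \in orthv <[v]>%VS.
  by rewrite -hdot_conj (orthvP _ _ uO) ?conjC0 ?memv_line.
rewrite -[u](id_lfunE u); apply: low_spaceP uN => [i y|i]; rewrite id_lfunE;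
  apply/orthvP => _ /vlineP[a ->]; rewrite hdotZl -hdot_conj; apply/eqP;
  rewrite mulf_eq0 conjC_eq0 [_ == 0 in X in _ || X]conjC_eq0; apply/orP; right; apply/eqP.
  rewrite /shell -dual_idem_selfadj.
  have [->|i2] := eqVneq i 2%N; last by rewrite v0 ?hdot0r.
  by rewrite v2 -dmx_selfadj -dual_idem_selfadj v1 hdot0r.
rewrite -dual_idem_selfadj; have [->|i2] := eqVneq i 2%N; last by rewrite v0 ?hdot0r.
rewrite v2 -J_delta -(selfadj_radial hG) => [|j]; last by rewrite conjC1.
by rewrite (local_sum0 hG vU) hdot0r.
Qed.

Lemma orth_low_dual1 w : w \in orthv low_space -> E 1 *m w = 0.
Proof.
move=> /orthvP wN; apply/colP => y; rewrite [RHS]mxE -hdot_delta dual_idem_selfadj.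
exact: wN (low_space1 _).
Qed.

Lemma orth_low_dual0 w : w \in orthv low_space -> E 0 *m w = 0.
Proof.
move=> /orthvP wN; apply/colP => y; rewrite [RHS]mxE -hdot_delta dual_idem_selfadj.
exact: wN (low_space0 _).
Qed.

End EndpointOne.

(** * Tautness at a vertex *)

Section TautVertices.
Variables (C : numClosedFieldType) (X : finType) (e : rel X).
Hypothesis hG : bipartite_drg e.
Hypothesis hodd : odd (diameter e).

Let hD : (4 <= diameter e)%N. Proof. by case: hG. Qed.

Local Notation D := (diameter e).
Local Notation d := (D./2).
Local Notation A := (adjmx C e).
Local Notation E := (dual_idem C e).
Local Notation B := (local_adj C e).
Local Notation theta := (theta C e).
Local Notation alpha := (tilde e (theta 1)).
Local Notation beta := (tilde e (theta d)).
Local Notation Q x := ((B x - alpha%:M) *m (B x - beta%:M)).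

Lemma taut_wrt_of_annihilated x :
  (forall v, local_space e x v -> Q x *m v = 0) -> taut_wrt C e x.
Proof.
move=> Q0 W irrW /(endpoint2P hG)[W0 W1 W2]; have [mW _ _] := irrW.
have [v [vW v0 vU [Bv|Bv]]] := local_eigenvector hG mW W1 W2 Q0.
  have e1 : eigenvalue A (theta 1).
    by rewrite (eigenvalue_theta C hG) // (diam_gt0 hG).
  have [tW lW] := thin_of_eigenvector hG e1 (theta1_gap C hG hodd) vU Bv irrW vW v0.
  by split=> //; left.
have ed : eigenvalue A (theta d) by rewrite (eigenvalue_theta C hG) //; lia.
have [tW lW] := thin_of_eigenvector hG ed (theta_half_gap C hG hodd) vU Bv irrW vW v0.
by split=> //; right.
Qed.

(** The complement of [low_space] is a module containing the local space; on each
    of its irreducible parts tautness makes [E 2 w] zero or an eigenvector of [B]. *)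
Lemma annihilated_of_taut_wrt x :
  taut_wrt C e x -> forall v, local_space e x v -> Q x *m v = 0.
Proof.
move=> tx v vU; have [v2 _] := vU; rewrite -[v in LHS]v2.
have := local_space_low hG vU; move: v {vU v2}.
apply: (irreducible_ind hG (x := x)).
- by rewrite !mulmx0.
- by move=> u v u0 v0; rewrite [E x 2 *m (u + v)]mulmxDr [Q x *m (_ + _)]mulmxDr u0 v0 addr0.
- exact: (Tmodule_orthv hG (low_space_module hG (x := x))).
move=> W irrW WS w wW; have [W2|W2] := eqVneq (dual_part e x 2 W) 0%VS.
  by rewrite (dual_part_eq0 W2 wW) mulmx0.
have W0 : dual_part e x 0 W = 0%VS.
  apply/eqP; rewrite -subv0; apply/subvP => _ /dual_partP[u uW ->].
  by rewrite (orth_low_dual0 hG) ?mem0v ?(subvP WS).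
have W1 : dual_part e x 1 W = 0%VS.
  apply/eqP; rewrite -subv0; apply/subvP => _ /dual_partP[u uW ->].
  by rewrite (orth_low_dual1 hG) ?mem0v ?(subvP WS).
have [_ lW] := tx W irrW (endpoint2I hG W0 W1 W2).
have Ew := mem_dual_part e x 2 wW; move: (E x 2 *m w) Ew => u uW.
have [/(_ u uW) Bu|/(_ u uW) Bu] := lW.
  rewrite local_shift_comm -mulmxA [(B x - alpha%:M) *m u]mulmxBl mul_scalar_mx.
  by rewrite Bu subrr mulmx0.
by rewrite -mulmxA [(B x - beta%:M) *m u]mulmxBl mul_scalar_mx Bu subrr mulmx0.
Qed.

End TautVertices.

Theorem theorem16p4 (R : realType) (X : finType) (e : rel X)
  (hgraph : simple_connected_graph e)
  (hbip : bipartite e)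
  (hdr : distance_regular e)
  (hD : (4 <= diameter e)%N)
  (hk : (3 <= valency e)%N)
  (hodd : odd (diameter e)) :
  (taut (complex R) e <->
     (Delta (complex R) e != 0 /\ forall x : X, taut_wrt (complex R) e x)) /\
  ((Delta (complex R) e != 0 /\ forall x : X, taut_wrt (complex R) e x) <->
     (Delta (complex R) e != 0 /\ exists x : X, taut_wrt (complex R) e x)).
Proof.
have hG : bipartite_drg e by split.
have crit := taut_criterion (complex R) hG hodd hk.
have all_taut : taut (complex R) e -> forall x, taut_wrt (complex R) e x.
  move=> [_ eq] x; apply: (taut_wrt_of_annihilated hG hodd).
  exact: (crit x).1 eq.
have taut_one x : Delta (complex R) e != 0 -> taut_wrt (complex R) e x ->
    taut (complex R) e.
  move=> D0 tx; split=> //; apply: (crit x).2.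
  exact: annihilated_of_taut_wrt.
have [x0 _] := vertex_exists hG.
split; split.
- by move=> t; split; [case: t | exact: all_taut].
- by move=> [D0 tx]; apply: taut_one (tx x0).
- by move=> [D0 tx]; split=> //; exists x0.
- by move=> [D0 [x tx]]; split=> //; apply: all_taut; apply: taut_one tx.
Qed.
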